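(* For each positive integer $n$ let \[ \rho_n=\max_F\min_G d(F,G), \] where the maximum is over all functions $F:\mathbb{F}_2^n\to\mathbb{F}_2$, the minimum is over all $2^{n+1}$ affine functions $G:\mathbb{F}_2^n\to\mathbb{F}_2$, and $d(F,G)=\#\{y\in\mathbb{F}_2^n: F(y)\neq G(y)\}$ is the Hamming distance. Put $\mu_n=2^{n/2}-\rho_n/2^{n/2-1}$. Then $\lim_{n\to\infty}\mu_n=1$.
   Context: The number $\rho_n$ is the covering radius of the first-order Reed–Muller code of length $2^n$ and dimension $n+1$. *)

(* Defs.v *)
From HB Require Import structures.
From mathcomp Require Import all_boot all_order all_algebra.
From mathcomp Require Import all_classical all_reals all_analysis.

Set Implicit Arguments.
Unset Strict Implicit.
Unset Printing Implicit Defensive.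

Import GRing.Theory.
Local Open Scope ring_scope.

Definition boolean_function (n : nat) := {ffun 'rV['F_2]_n -> 'F_2}.

Definition affine_function (n : nat) (a : 'rV['F_2]_n) (b : 'F_2) :
    boolean_function n :=
  [ffun y : 'rV['F_2]_n => (\sum_(i < n) a 0 i * y 0 i) + b].

Definition affine_functions (n : nat) : {set boolean_function n} :=
  [set G | [exists a, exists b, G == affine_function a b]].

Definition hamming_dist (n : nat) (F G : boolean_function n) : nat :=
  #|[set y | F y != G y]|.

(* The unit 2 ^ n of the iterated minimum bounds every Hamming distance, so it
   does not affect the minimum over the nonempty set of affine functions. *)
Definition dist_to_affine (n : nat) (F : boolean_function n) : nat :=
  \big[minn/(2 ^ n)%N]_(G in affine_functions n) hamming_dist F G.

Definition rho (n : nat) : nat :=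
  (\max_(F : boolean_function n) dist_to_affine F)%N.

Definition mu (R : realType) (n : nat) : R :=
  2 `^ (n%:R / 2) - (rho n)%:R / 2 `^ (n%:R / 2 - 1).

(* Main.v *)
(** Up to normalisation, mu_n is the least value over sign functions of
    max |Walsh coefficient| / 2^(n/2). It is at least 1 by Parseval, equal to 1
    for even n (bent functions), and mu_(n+2) <= mu_n by tensoring with a bent
    function, so it suffices to find odd dimensions in which mu is close to 1.

    Over F = GF(2^n) with n odd and 7^k | 2^n - 1, a Gauss sum attached to a
    character of order 7^i > 1 is invariant under the Frobenius, hence lies in
    Z[a] with a = (1 + sqrt(-7)) / 2; having norm 2^n and being -1 modulo
    sqrt(-7), it equals - a^c (1 - a)^(n - c) for some c <= n. By Diophantine
    approximation of arg(a) / pi there is an odd m, tiny compared with 2^n, such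
    that the m-th power of each of these Gauss sums is within a small relative
    error of s 2^(nm/2), with one common sign s. Therefore a function
    f(y_1, ..., y_m) = h(sum_i log y_i mod 7^k) on F^m, where h takes the values
    0, 1, -1, vanishes only at 0 and has mean zero, has all Walsh coefficients at
    most (1 + eps) 2^(nm/2), and its zero set has small density.

    The zeros are removed after adding an even number 2s of variables: off the
    zero set one takes f(x) b(y) with b bent, and over the zero set x |-> a
    character of the second factor, different for each x. The latter part
    contributes at most 2^(2s) to any Walsh coefficient, which is negligible. *)

Require Import Defs.
From HB Require Import structures.
From mathcomp Require Import all_boot all_order all_algebra.
From mathcomp Require Import all_fingroup all_solvable all_field.
From mathcomp Require Import ring lra zify.
From mathcomp Require Import all_classical all_reals all_analysis.
Import numFieldNormedType.Exports.
Import Order.TTheory GRing.Theory Num.Theory.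

Set Implicit Arguments.
Unset Strict Implicit.
Unset Printing Implicit Defensive.

Local Open Scope ring_scope.

(** * Walsh coefficients *)

Definition sign (b : 'F_2) : int := (-1) ^+ (b : nat).

Definition dot n (a y : 'rV['F_2]_n) : 'F_2 := \sum_(i < n) a 0 i * y 0 i.

Definition walsh n (f : 'rV['F_2]_n -> int) (a : 'rV['F_2]_n) : int :=
  \sum_y f y * sign (dot a y).

Lemma F2_cases (b : 'F_2) : b = 0 \/ b = 1.
Proof. by case: b => [[|[|[]]]] // h; [left | right]; apply: val_inj. Qed.

Lemma sign0 : sign 0 = 1. Proof. by []. Qed.

Lemma signD b c : sign (b + c) = sign b * sign c.
Proof. by case: (F2_cases b) => ->; case: (F2_cases c) => ->. Qed.

Lemma sign_sqr b : sign b * sign b = 1.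
Proof. by case: (F2_cases b) => ->. Qed.

Lemma normr_sign b : `|sign b| = 1.
Proof. by case: (F2_cases b) => ->. Qed.

Lemma addF2 (b : 'F_2) : b + b = 0.
Proof. by case: (F2_cases b) => ->; apply: val_inj. Qed.

Lemma dotC n (a y : 'rV['F_2]_n) : dot a y = dot y a.
Proof. by apply: eq_bigr => i _; rewrite mulrC. Qed.

Lemma dotDr n (a x y : 'rV['F_2]_n) : dot a (x + y) = dot a x + dot a y.
Proof. by rewrite -big_split; apply: eq_bigr => i _; rewrite mxE mulrDr. Qed.

Lemma dotDl n (a b y : 'rV['F_2]_n) : dot (a + b) y = dot a y + dot b y.
Proof. by rewrite -!(dotC y) dotDr. Qed.

Lemma dot0 n (y : 'rV['F_2]_n) : dot 0 y = 0.
Proof. by rewrite /dot big1 // => i _; rewrite mxE mul0r. Qed.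

Lemma dot_row_mx n m (a x : 'rV['F_2]_n) (b y : 'rV['F_2]_m) :
  dot (row_mx a b) (row_mx x y) = dot a x + dot b y.
Proof.
by rewrite /dot big_split_ord; congr (_ + _); apply: eq_bigr => i _;
  rewrite ?row_mxEl ?row_mxEr.
Qed.

Lemma card_F2_rV n : #|{: 'rV['F_2]_n}| = (2 ^ n)%N.
Proof. by rewrite card_mx mul1n card_Fp. Qed.

Lemma F2_rV_addK n (a b : 'rV['F_2]_n) : a + b + b = a.
Proof. by apply/rowP => i; rewrite !mxE -addrA addF2 addr0. Qed.

Lemma F2_rV_addr_eq0 n (a b : 'rV['F_2]_n) : (a + b == 0) = (a == b).
Proof.
apply/eqP/eqP => [h|->]; first by rewrite -[a](F2_rV_addK a b) h add0r.
by apply/rowP => i; rewrite !mxE addF2.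
Qed.

(** If some coordinate of [a] is 1, translating by that basis vector flips every sign, so the sum is
    its own negative. *)
Lemma sum_sign_dot n (a : 'rV['F_2]_n) :
  \sum_y sign (dot a y) = if a == 0 then 2 ^+ n else 0.
Proof.
case: eqVneq => [->|a_neq0].
  under eq_bigr do rewrite dot0 sign0.
  by rewrite sumr_const card_F2_rV natrX.
have [i ai] : exists i, a 0 i = 1.
  have /existsP[i ai] : [exists i, a 0 i != 0].
    apply: contraNT a_neq0 => /existsPn h; apply/eqP/rowP => i.
    by rewrite mxE; apply/eqP/negPn/h.
  by exists i; case: (F2_cases (a 0 i)) ai => ->.
pose e : 'rV['F_2]_n := \row_j (j == i)%:R.
have ae : dot a e = 1.
  rewrite /dot (bigD1 i) //= big1 => [|j ji]; last by rewrite mxE (negPf ji) mulr0.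
  by rewrite mxE eqxx mulr1 addr0.
set S := \sum_y _; have : S = - S.
  rewrite {1}/S (reindex_inj (addIr e)) /= -sumrN; apply: eq_bigr => y _.
  by rewrite dotDr signD ae mulrN1.
lia.
Qed.


Lemma sum_row_mx n m (h : 'rV['F_2]_(n + m) -> int) :
  \sum_x h x = \sum_x \sum_y h (row_mx x y).
Proof.
rewrite pair_big (reindex (fun p : 'rV['F_2]_n * 'rV_m => row_mx p.1 p.2)) //=.
by exists (fun x => (lsubmx x, rsubmx x)) => [[x y] _|x _];
  rewrite ?row_mxKl ?row_mxKr ?hsubmxK.
Qed.

(** When the sum over [a] is taken first, orthogonality of characters kills the cross terms with
    [x != y]. *)
Lemma parseval n (f : 'rV['F_2]_n -> int) :
  \sum_a walsh f a ^+ 2 = 2 ^+ n * \sum_x f x ^+ 2.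
Proof.
under eq_bigr => a _.
  rewrite expr2 /walsh mulr_suml.
  under eq_bigr do rewrite mulr_sumr.
  over.
rewrite exchange_big mulr_sumr; apply: eq_bigr => x _ /=.
rewrite exchange_big /= (bigD1 x) //= [X in _ + X]big1 => [|y yx].
  under eq_bigr do rewrite mulrACA sign_sqr mulr1.
  by rewrite addr0 sumr_const card_F2_rV -[_ *+ (2 ^ n)]mulr_natl natrX expr2.
transitivity (\sum_a f x * f y * sign (dot (x + y) a)).
  by apply: eq_bigr => a _; rewrite mulrACA !(dotC a) -signD -dotDl.
by rewrite -mulr_sumr sum_sign_dot F2_rV_addr_eq0 eq_sym (negPf yx) mulr0.
Qed.

(* Distinct characters are orthogonal, so for each b at most one x contributes. *)
Lemma normr_sum_dot_inj (T : finType) n (P : pred T) (t : T -> 'rV['F_2]_n)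
    (w : T -> int) (b : 'rV['F_2]_n) :
  {in P &, injective t} -> (forall x, `|w x| <= 1) ->
  `|\sum_(x | P x) \sum_y w x * (sign (dot (t x) y) * sign (dot b y))| <= 2 ^+ n.
Proof.
move=> inj_t w1.
have E x : \sum_y w x * (sign (dot (t x) y) * sign (dot b y))
    = w x * (if t x == b then 2 ^+ n else 0).
  rewrite -mulr_sumr -F2_rV_addr_eq0 -sum_sign_dot.
  by under eq_bigr do rewrite -signD -dotDl.
under eq_bigr do rewrite E.
have [/existsP[x /andP[Px /eqP tx]]|/existsPn no_x] := boolP [exists x, P x && (t x == b)].
  rewrite (bigD1 x) //= big1 => [|y /andP[Py yx]].
    rewrite tx eqxx addr0 normrM [X in _ * X <= _]ger0_norm ?exprn_ge0 //.
    by rewrite ler_piMl ?exprn_ge0.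
  case: eqP => [ty|]; last by rewrite mulr0.
  by move: yx; rewrite (inj_t y x) ?eqxx // ty.
rewrite big1 ?normr0 ?exprn_ge0 // => x Px.
by move: (no_x x); rewrite Px /= => /negPf ->; rewrite mulr0.
Qed.

(** Squares equal to 1 encode values 1 and -1. By Parseval [B ^+ 2] is at least [2 ^+ n]; bent
    functions attain this bound. *)
Definition flat n (B : int) := exists f : 'rV['F_2]_n -> int,
  (forall x, f x ^+ 2 = 1) /\ forall a, `|walsh f a| <= B.

(** The Walsh transform of a product in separate variables factors. *)
Lemma flat_tensor n m B C : flat n B -> flat m C -> flat (n + m) (B * C).
Proof.
move=> [f [f1 fB]] [g [g1 gC]].
exists (fun x => f (lsubmx x) * g (rsubmx x)); split=> [x|c].
  by rewrite exprMn f1 g1.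
rewrite -[c]hsubmxK; set a := lsubmx c; set b := rsubmx c.
have -> : walsh (fun x => f (lsubmx x) * g (rsubmx x)) (row_mx a b)
    = walsh f a * walsh g b.
  rewrite /walsh sum_row_mx mulr_suml; apply: eq_bigr => x _.
  rewrite mulr_sumr; apply: eq_bigr => y _.
  by rewrite row_mxKl row_mxKr dot_row_mx signD mulrACA.
by rewrite normrM ler_pM.
Qed.

(** The inner product of the two halves works: for a fixed left half it is a character of the right
    half, and different left halves give different characters. *)
Lemma flat_bent s : flat (s + s) (2 ^+ s).
Proof.
exists (fun x => sign (dot (lsubmx x) (rsubmx x))); split=> [x|c].
  by rewrite expr2 sign_sqr.
rewrite -[c]hsubmxK; set a := lsubmx c; set b := rsubmx c.
have -> : walsh (fun x : 'rV_(s + s) => sign (dot (lsubmx x) (rsubmx x))) (row_mx a b)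
    = \sum_x \sum_y sign (dot a x) * (sign (dot x y) * sign (dot b y)).
  rewrite /walsh sum_row_mx; apply: eq_bigr => x _; apply: eq_bigr => y _.
  by rewrite row_mxKl row_mxKr dot_row_mx signD mulrCA.
by apply: (@normr_sum_dot_inj _ s xpredT id) => // x; rewrite normr_sign.
Qed.

(* Off the zero set of f0 the function is f0 tensored with a bent function; over
   the zero set it consists of pairwise distinct characters of the second factor. *)
Lemma flat_fill N s B (f0 : 'rV['F_2]_N -> int) :
  (forall x, f0 x = 0 \/ f0 x ^+ 2 = 1) -> (forall a, `|walsh f0 a| <= B) ->
  (#|[pred x | f0 x == 0]| <= 2 ^ (s + s))%N ->
  flat (N + (s + s)) (B * 2 ^+ s + 2 ^+ (s + s)).
Proof.
move=> f01 f0B le_zero; have [g [g1 gB]] := flat_bent s.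
pose Z := [pred x | f0 x == 0].
(* The element of rank k in the zero set gets the vector of rank k; there are enough vectors by
   [le_zero]. *)
pose t x : 'rV['F_2]_(s + s) := nth 0 (enum {: 'rV['F_2]_(s + s)}) (index x (enum Z)).
have t_inj : {in Z &, injective t}.
  have lt_index x : x \in Z -> (index x (enum Z) < size (enum {: 'rV['F_2]_(s + s)}))%N.
    move=> Zx; rewrite -cardE card_F2_rV; apply: leq_trans le_zero.
    by rewrite [ltnRHS]cardE index_mem mem_enum.
  move=> x y Zx Zy /eqP; rewrite nth_uniq ?enum_uniq ?lt_index // => /eqP h.
  have := congr1 (nth 0 (enum Z)) h.
  by rewrite !nth_index ?mem_enum.
exists (fun x => if f0 (lsubmx x) == 0 then sign (dot (t (lsubmx x)) (rsubmx x))
                 else f0 (lsubmx x) * g (rsubmx x)); split=> [x|c].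
  case: eqP => [_|f0x]; first by rewrite expr2 sign_sqr.
  by rewrite exprMn g1; case: (f01 (lsubmx x)) => // ->.
rewrite -[c]hsubmxK; set a := lsubmx c; set b := rsubmx c.
rewrite /walsh sum_row_mx (bigID Z) /= addrC.
apply: le_trans (ler_normD _ _) _; apply: lerD.
  rewrite [X in `|X|](_ : _ = walsh f0 a * walsh g b); first by rewrite normrM ler_pM.
  rewrite /walsh [X in _ = X * _](bigID Z) /= [X in _ = (X + _) * _]big1; last first.
    by move=> x /eqP ->; rewrite mul0r.
  rewrite add0r mulr_suml; apply: eq_bigr => x /negPf Zx.
  rewrite mulr_sumr; apply: eq_bigr => y _.
  by rewrite row_mxKl row_mxKr dot_row_mx signD Zx mulrACA.
rewrite [X in `|X|](_ : _ = \sum_(x | Z x) \sum_y sign (dot a x) *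
    (sign (dot (t x) y) * sign (dot b y))); last first.
  apply: eq_bigr => x Zx; apply: eq_bigr => y _.
  by rewrite row_mxKl row_mxKr dot_row_mx signD Zx mulrCA.
by apply: normr_sum_dot_inj => // x; rewrite normr_sign.
Qed.

(** * Reduction to odd dimensions *)

(** Agreements minus disagreements give the signed Walsh coefficient, and their total is 2^n. *)
Lemma hamming_dist_affine n (F : boolean_function n) a b :
  2 * (hamming_dist F (affine_function a b))%:Z
    = 2 ^+ n - sign b * walsh (fun y => sign (F y)) a.
Proof.
have E (c d : 'F_2) : sign c * sign d = 1 - 2 * ((c != d) : nat)%:Z.
  by case: (F2_cases c) => ->; case: (F2_cases d) => ->.
have -> : sign b * walsh (fun y => sign (F y)) a
    = \sum_y sign (F y) * sign (affine_function a b y).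
  rewrite mulr_sumr; apply: eq_bigr => y _.
  rewrite ffunE signD -/(dot a y) mulrCA; congr (_ * _); exact: mulrC.
under eq_bigr do rewrite E.
rewrite sumrB sumr_const card_F2_rV natrX opprB addrC subrK -mulr_sumr; congr (_ * _).
rewrite /hamming_dist cardsE -sum1_card big_mkcond -[LHS]natz natr_sum; apply: eq_bigr => y _.
by rewrite unfold_in /=; case: (F y != _).
Qed.

Lemma bigminn_le (I : eqType) (r : seq I) (P : pred I) (u : nat) (d : I -> nat) i :
  i \in r -> P i -> (\big[minn/u]_(j <- r | P j) d j <= d i)%N.
Proof.
move=> + Pi; elim: r => // j r IHr; rewrite inE big_cons.
case/orP=> [/eqP<-|/IHr le_i]; first by rewrite Pi geq_minl.
by case: ifP => // _; rewrite geq_min le_i orbT.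
Qed.

Lemma affine_functionP n (G : boolean_function n) :
  reflect (exists a b, G = affine_function a b) (G \in affine_functions n).
Proof.
rewrite inE; apply: (iffP existsP) => [[a /existsP[b /eqP->]]|[a [b ->]]].
  by exists a, b.
by exists a; apply/existsP; exists b.
Qed.

Lemma rho_ge n B : flat n B -> 2 ^+ n - B <= 2 * (rho n)%:Z.
Proof.
move=> [f [f1 fB]].
have B_ge0 : 0 <= B := le_trans (normr_ge0 _) (fB 0).
pose F : boolean_function n := [ffun y => if f y == 1 then 0 else 1].
have FE y : sign (F y) = f y.
  rewrite ffunE; case: eqP => [->//|/eqP f_neq1].
  have /eqP := f1 y; rewrite sqrf_eq1 (negPf f_neq1) /= => /eqP->; by [].
apply: (@le_trans _ _ (2 * (dist_to_affine F)%:Z)); last first.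
  by rewrite ler_pM2l // lez_nat leq_bigmax.
rewrite /dist_to_affine; elim/big_ind: _ => [|x y|G /affine_functionP[a [b ->]]].
(* The default value [2 ^ n] of the iterated minimum satisfies the bound because [B] is
   nonnegative. *)
- have : 0 <= 2 ^+ n :> int by rewrite exprn_ge0.
  by rewrite -[(2 ^ n)%N%:Z]natz natrX; lia.
- by rewrite /minn; case: ifP.
rewrite hamming_dist_affine lerD2l lerN2.
have -> : walsh (fun y => sign (F y)) a = walsh f a.
  by apply: eq_bigr => y _; rewrite FE.
apply: le_trans (ler_norm _) _; by rewrite normrM normr_sign mul1r.
Qed.

(** By Parseval the mean square of the Walsh coefficients is 2^n, so one of them is at least that
    large. The bound is kept free of square roots; the second inequality gives the sign needed to
    extract one later. *)
Lemma rho_le n : 2 ^+ n <= (2 ^+ n - 2 * (rho n)%:Z) ^+ 2 /\ 2 * (rho n)%:Z <= 2 ^+ n.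
Proof.
have [F ->] : exists F : boolean_function n, rho n = dist_to_affine F.
  exists [arg max_(F > [ffun=> 0] : boolean_function n) dist_to_affine F].
  rewrite /rho; exact: bigmax_eq_arg.
pose f y := sign (F y).
have [a le_a] : exists a, 2 ^+ n <= walsh f a ^+ 2.
  apply/not_existsP => no_a.
  have : \sum_a walsh f a ^+ 2 < \sum_(a : 'rV['F_2]_n) 2 ^+ n.
    apply: ltr_sum => [|a _]; last by rewrite ltNge; apply/negP/no_a.
    by apply/hasP; exists 0; rewrite ?mem_index_enum.
  rewrite parseval; under eq_bigr do rewrite expr2 sign_sqr.
  by rewrite !sumr_const card_F2_rV -[X in _ < X]mulr_natr natrX ltxx.
(* The constant term [b] makes the correlation with the affine function nonnegative. *)
have [b hb] : exists b, sign b * walsh f a = `|walsh f a|.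
  case: (ger0P (walsh f a)) => _; first by exists 0; rewrite mul1r.
  by exists 1; rewrite mulN1r.
have le_d : 2 * (dist_to_affine F)%:Z <= 2 ^+ n - `|walsh f a|.
  rewrite -hb -hamming_dist_affine ler_pM2l // lez_nat.
  apply: bigminn_le; first exact: mem_index_enum.
  by apply/affine_functionP; exists a, b.
have le_w : `|walsh f a| <= 2 ^+ n - 2 * (dist_to_affine F)%:Z by lia.
split; last by have := normr_ge0 (walsh f a); lia.
apply: le_trans le_a _; rewrite -real_normK ?num_real //.
by rewrite lerXn2r // nnegrE // (le_trans _ le_w).
Qed.

(** * Normalisation of mu and passage to the limit *)

Section Limit.
Variable R : realType.

Let s (n : nat) : R := Num.sqrt 2 ^+ n.

Let s_gt0 n : 0 < s n. Proof. by rewrite exprn_gt0 // sqrtr_gt0. Qed.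

Let s_sqr n : s n ^+ 2 = 2 ^+ n. Proof. by rewrite exprAC sqr_sqrtr. Qed.

Lemma muE n : mu R n = (2 ^+ n - 2 * (rho n)%:Z)%:~R / s n.
Proof.
have sE : 2 `^ (n%:R / 2) = s n :> R.
  by rewrite mulrC powRrM powR12_sqrt // powR_mulrn // sqrtr_ge0.
rewrite /mu powRB // ?sE; last by rewrite pnatr_eq0 implybT.
rewrite powRr1 // intrB intrM rmorphXn /= mulrBl -[2%:~R]/(2 : R).
by rewrite -s_sqr expr2 mulfK ?gt_eqF // invf_div mulrA (mulrC _ 2).
Qed.

Lemma mu_ge1 n : 1 <= mu R n.
Proof.
have [h1 h2] := rho_le n; rewrite muE ler_pdivlMr // mul1r.
rewrite -(ler_pXn2r (n := 2)) ?nnegrE ?ler0z ?(ltW (s_gt0 n)) //; last by lia.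
by move: h1; rewrite s_sqr -(ler_int R) !rmorphXn.
Qed.

Lemma mu_le_flat n B : flat n B -> mu R n <= B%:~R / s n.
Proof.
move=> /rho_ge h; rewrite muE ler_pM2r ?invr_gt0 // ler_int; lia.
Qed.

(** Even dimensions are settled by bent functions. A single good odd dimension [N] settles all
    larger odd ones, since tensoring with a bent function keeps the ratio [B / s N]. *)
Lemma mu_cvg_of_flat :
  (forall e : R, 0 < e -> exists N B, [/\ odd N, flat N B & B%:~R <= (1 + e) * s N]) ->
  (mu R n @[n --> \oo] --> (1 : R))%classic.
Proof.
move=> odd_flat; apply/cvgrPdist_le => e e_gt0.
have [N [B [odd_N flatB leB]]] := odd_flat e e_gt0.
near=> n.
have leNn : (N <= n)%N by near: n; exact: nbhs_infty_ge.
suff : mu R n <= 1 + e.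
  by have := mu_ge1 n; rewrite ler_norml; lra.
have [odd_n|even_n] := boolP (odd n).
  have [k nE] : exists k, n = (N + (k + k))%N by exists (n - N)./2; lia.
  have := mu_le_flat (flat_tensor flatB (flat_bent k)); rewrite -nE => /le_trans; apply.
  rewrite ler_pdivrMr // nE /s exprD -/(s N) intrM mulrA rmorphXn /= exprD.
  by rewrite -exprMn -expr2 sqr_sqrtr // ler_pM2r // exprn_gt0.
have nE : n = (n./2 + n./2)%N by lia.
have := mu_le_flat (flat_bent n./2); rewrite -nE => /le_trans; apply.
rewrite ler_pdivrMr // {2}nE /s exprD -exprMn -expr2 sqr_sqrtr // rmorphXn /=.
by rewrite ler_peMl ?exprn_ge0 //; lra.
Unshelve. all: by end_near.
Qed.

End Limit.

(** * Approximation of the angle of (1 + sqrt(-7)) / 2 *)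

Lemma dirichlet_approximation (R : realType) (x : R) (Q : nat) : (0 < Q)%N ->
  exists d (p : int), [/\ (0 < d <= Q)%N, coprime d `|p|%N
    & `|d%:R * x - p%:~R| < Q%:R^-1].
Proof.
move=> Q_gt0; have QR_gt0 : 0 < Q%:R :> R by rewrite ltr0n.
suff [d [p [/andP[d_gt0 leQ] ltx]]] : exists d (p : int),
    [/\ (0 < d <= Q)%N & `|d%:R * x - p%:~R| < Q%:R^-1].
  (* Dividing denominator and numerator by their gcd only shrinks the error, so coprimality comes
     for free. *)
  pose g := gcdn d `|p|; have gE : gcdn d `|p| = g by [].
  have /dvdnP[e de] : (g %| d)%N by rewrite dvdn_gcdl.
  have /dvdzP[r pr] : (g%:Z %| p)%Z by rewrite dvdzE /= dvdn_gcdr.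
  have g_gt0 : (0 < g)%N by rewrite gcdn_gt0 d_gt0.
  move: (g) gE de pr g_gt0 => {}g gE de pr g_gt0; subst d p.
  exists e, r; split.
  - have e_gt0 : (0 < e)%N by case: e d_gt0 {leQ ltx gE}.
    by rewrite e_gt0 (leq_trans _ leQ) // leq_pmulr.
  - by move/eqP: gE; rewrite abszM /= -muln_gcdl -[eqbRHS]mul1n eqn_pmul2r.
  - apply: le_lt_trans ltx; rewrite natrM intrM -[(g%:Z)%:~R]/(g%:R).
    have -> : e%:R * g%:R * x - r%:~R * g%:R = g%:R * (e%:R * x - r%:~R) :> R.
      by ring.
    by rewrite normrM normr_nat ler_peMl // ler1n.
(* Pigeonhole: the fractional parts of the Q + 1 multiples i x with 0 <= i <= Q fall into Q boxes of
   width 1/Q. *)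
pose fl (y : R) : int := Num.floor y.
pose fr (i : nat) : R := i%:R * x - (fl (i%:R * x))%:~R.
have fr01 i : 0 <= fr i < 1.
  have /andP[h1 h2] := floor_itv (i%:R * x).
  rewrite /fr /fl; rewrite intrD in h2; lra.
have flP i : (`|fl ((Q%:R : R) * fr i : R)%R| < Q)%N.
  have /andP[h1 h2] := fr01 i.
  have : fl (Q%:R * fr i) < Q%:Z.
    by rewrite /fl floor_lt_int -[_%:~R]/(Q%:R) gtr_pMr.
  have : 0 <= fl (Q%:R * fr i) by rewrite /fl floor_ge0 mulr_ge0 // ltW.
  lia.
pose F (i : 'I_Q.+1) := Ordinal (flP i).
have /injectivePn[i [j ij Fij]] : ~~ injectiveb F.
  by apply/injectiveP => /leq_card; rewrite !card_ord ltnn.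
wlog ltij : i j ij Fij / (i < j)%N.
  move=> H; case: (ltngtP i j) => h; first exact: (H i j).
    by apply: (H j i) => //; rewrite eq_sym.
  by move: ij; rewrite (ord_inj h) eqxx.
exists (j - i)%N, (fl (j%:R * x) - fl (i%:R * x)); split.
  by rewrite subn_gt0 ltij /= (leq_trans (leq_subr _ _)) // -ltnS.
have E : fl (Q%:R * fr i) = fl (Q%:R * fr j).
  have Ni k : 0 <= fl (Q%:R * fr k).
    by rewrite /fl floor_ge0 mulr_ge0 ?(ltW QR_gt0) //; case/andP: (fr01 k).
  have := congr1 val Fij; rewrite /= => H.
  by rewrite -[LHS]gez0_abs // -[RHS]gez0_abs // H.
have /andP[a1 a2] := floor_itv (Q%:R * fr i).
have /andP[b1 b2] := floor_itv (Q%:R * fr j).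
rewrite -!/(fl _) E in a1 a2; rewrite -!/(fl _) in b1 b2.
rewrite natrB ?(ltnW ltij) // mulrBl intrB.
have -> : j%:R * x - i%:R * x - ((fl (j%:R * x))%:~R - (fl (i%:R * x))%:~R)
  = fr j - fr i by rewrite /fr; ring.
rewrite -(ltr_pM2l QR_gt0) mulfV ?gt_eqF // -{1}(ger0_norm (ltW QR_gt0)).
rewrite -normrM mulrBr ltr_norml; rewrite !intrD in a1 a2 b1 b2; lra.
Qed.

(* If p/d is a reduced approximation with d even, then p is odd and the inverse
   of p modulo d is an odd denominator whose approximation is as good up to 1/d. *)
Lemma odd_denominator (R : realType) (x : R) (Q d : nat) (p : int) :
  (0 < d <= Q)%N -> coprime d `|p| -> `|d%:R * x - p%:~R| < Q%:R^-1 ->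
  exists m (r : int), [/\ odd m, (m <= d)%N & `|m%:R * x - r%:~R| <= 2 / d%:R].
Proof.
move=> /andP[d_gt0 leQ] cop lt_x.
have dR_gt0 : 0 < d%:R :> R by rewrite ltr0n.
have QV : Q%:R^-1 <= d%:R^-1 :> R.
  by rewrite lef_pV2 ?posrE ?ltr0n // ?ler_nat // (leq_trans d_gt0).
have [odd_d | even_d] := boolP (odd d).
  exists d, p; split=> //; apply: ltW (lt_le_trans lt_x (le_trans QV _)).
  by rewrite ler_peMl ?invr_ge0 ?ler0n // ler1n.
have d_gt1 : (1 < d)%N by case: d d_gt0 even_d {dR_gt0 QV lt_x cop leQ} => [|[]].
have cz : coprimez d%:Z p by rewrite coprimezE.
have [[u v] /= uv] : exists uv : int * int, uv.1 * d%:Z + uv.2 * p = 1.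
  have [u [v]] := Bezoutz d%:Z p; rewrite (eqP cz) => h.
  by exists (u, v).
(* Here [m] is the inverse of [p] modulo [d]. From m p = 1 + d r follows d (m x - r) = m (d x - p) +
   1, which is at most 2 in absolute value. *)
pose m := (v %% d%:Z)%Z.
have m_ge0 : 0 <= m by rewrite modz_ge0 // lt0r_neq0.
have m_lt : m < d%:Z by rewrite ltz_pmod.
pose r : int := - (u + (v %/ d%:Z)%Z * p).
have mpE : m * p = 1 + d%:Z * r.
  have mE : m = v - (v %/ d%:Z)%Z * d%:Z 
    by apply/eqP; rewrite eq_sym subr_eq addrC -divz_eq.
  by rewrite /r mE -uv; ring.
exists `|m|%N, r; split; first 2 last.
- rewrite -(ler_pM2l dR_gt0) -{1}(gtr0_norm dR_gt0) -normrM.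
  have -> : d%:R * (`|m|%:R * x - r%:~R) = `|m|%:R * (d%:R * x - p%:~R) + 1 :> R.
    have : (m * p)%:~R = (1 + d%:Z * r)%:~R :> R by rewrite mpE.
    rewrite intrD !intrM -[(d%:Z)%:~R]/(d%:R) -(gez0_abs m_ge0).
    rewrite -[(`|m|%:Z)%:~R]/(`|m|%:R) => h.
    by rewrite !mulrBr h; ring.
  have -> : d%:R * (2 / d%:R) = 1 + 1 :> R by rewrite mulrCA mulfV ?gt_eqF // mulr1.
  apply: le_trans (ler_normD _ _) _; rewrite normr1 lerD2r normrM normr_nat.
  apply: le_trans (_ : d%:R * d%:R^-1 <= _); last by rewrite mulfV ?gt_eqF.
  apply: ler_pM => //; last exact: ltW (lt_le_trans lt_x QV).
  by rewrite ler_nat; lia.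
(* Since [d] is even, m p = 1 + d r is odd, and hence so is [m]. *)
- apply/negPn/negP => even_m.
  have : (2 %| m * p)%Z by rewrite dvdz_mulr // dvdzE /= dvdn2.
  have : (2 %| d%:Z * r)%Z by rewrite dvdz_mulr // dvdzE /= dvdn2.
  by rewrite mpE; lia.
- by lia.
Qed.

(* [lucasU m] is (a^m - b^m) / (a - b) for the roots a, b of X^2 - X + 2. *)
Fixpoint lucas_pair (m : nat) : int * int :=
  if m is k.+1 then ((lucas_pair k).2, (lucas_pair k).2 - 2 * (lucas_pair k).1)
  else (0, 1).

Definition lucasU (m : nat) : int := (lucas_pair m).1.

Lemma lucasU_rec m : lucasU m.+2 = lucasU m.+1 - 2 * lucasU m.
Proof. by []. Qed.

(** Modulo 2 the recurrence repeats its last value, so all terms from index 1 on are odd. *)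
Lemma lucasU_neq0 m : lucasU m.+1 != 0.
Proof.
suff: (lucasU m.+1 %% 2)%Z = 1 by apply: contra_eq_neq => ->.
elim: m => // m IHm; rewrite lucasU_rec; lia.
Qed.

Lemma normr_sin_le (R : realType) (x : R) : `|sin x| <= `|x|.
Proof.
wlog x_gt0 : x / 0 < x.
  move=> H; case: (ltgtP x 0) => [x0|/H//|->]; last by rewrite sin0 normr0.
  by rewrite -(normrN x) -(normrN (sin x)) -sinN; apply: H; rewrite oppr_gt0.
have [|c _] := @MVT R sin cos 0 x x_gt0 (fun y _ => is_derive_sin y).
  exact: (continuous_subspaceT (@continuous_sin R)).
rewrite sin0 !subr0 => ->; rewrite normrM ler_piMl //.
by rewrite ler_norml cos_geN1 cos_le1.
Qed.

Lemma normr_sinDpi (R : realType) (x : R) (p : int) :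
  `|sin (x - p%:~R * pi)| = `|sin x|.
Proof.
have sin_nat (y : R) (k : nat) : `|sin (y + k%:R * pi)| = `|sin y|.
  elim: k => [|k IHk]; first by rewrite mul0r addr0.
  by rewrite -addn1 natrD mulrDl mul1r addrA sinDpi normrN.
case: (intP p) => [|k|k]; first by rewrite mul0r subr0.
  by rewrite -[LHS](sin_nat _ k.+1) subrK.
by rewrite mulrNz mulNr opprK sin_nat.
Qed.

Section Angle.
Variable R : realType.

Let s2 : R := Num.sqrt 2.
Let s7 : R := Num.sqrt 7.
(** This is the argument of (1 + sqrt(-7)) / 2, which has real part 1/2 and modulus sqrt 2. *)
Let theta : R := acos (s2^-1 / 2).

Let s2_gt0 : 0 < s2. Proof. by rewrite sqrtr_gt0. Qed.
Let s7_gt0 : 0 < s7. Proof. by rewrite sqrtr_gt0. Qed.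
Let s2E : s2 ^+ 2 = 2. Proof. by rewrite sqr_sqrtr. Qed.
Let s7E : s7 ^+ 2 = 7. Proof. by rewrite sqr_sqrtr. Qed.
Let s2V : s2^-1 = s2 / 2.
Proof.
by apply: (mulfI (lt0r_neq0 s2_gt0)); rewrite mulfV ?gt_eqF // mulrA -expr2 s2E mulfV.
Qed.

Let s2_itv : -1 <= s2^-1 / 2 <= 1.
Proof.
rewrite s2V; have : s2 <= 2.
  by rewrite -(ler_pXn2r (n := 2)) ?nnegrE ?s2E ?(ltW s2_gt0) //; lra.
by move: s2_gt0; lra.
Qed.

Lemma cos_angle : cos theta = s2 / 4.
Proof. rewrite /theta acosK; [rewrite s2V; lra | by rewrite in_itv]. Qed.

Lemma sin_angle : s2 * sin theta = s7 / 2.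
Proof.
apply/eqP; rewrite -(eqrXn2 (n := 2)) //; last 2 first.
- by rewrite mulr_ge0 ?(ltW s2_gt0) // sin_acos // sqrtr_ge0.
- by rewrite divr_ge0 // ltW.
have := cos2Dsin2 theta; rewrite cos_angle !exprMn s2E s7E => h.
by apply/eqP; lra.
Qed.

(** Binet's formula for the conjugate roots of modulus sqrt 2 and arguments [theta], [- theta],
    whose difference is i sqrt 7; it is proved through the recurrence to stay within the reals. *)
Lemma lucasU_sin m : s7 * (lucasU m)%:~R = 2 * (s2 ^+ m * sin (m%:R * theta)).
Proof.
suff [] : s7 * (lucasU m)%:~R = 2 * (s2 ^+ m * sin (m%:R * theta)) /\
    s7 * (lucasU m.+1)%:~R = 2 * (s2 ^+ m.+1 * sin (m.+1%:R * theta)) by [].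
elim: m => [|m [IH0 IH1]].
  split; first by rewrite mul0r sin0 !mulr0.
  by rewrite mul1r expr1 sin_angle mulrCA mulfV // .
split=> //; rewrite lucasU_rec intrB intrM mulrBr mulrCA IH1 IH0.
have -> : m.+2%:R * theta = m.+1%:R * theta + theta.
  by rewrite -(addn1 m.+1) natrD mulrDl mul1r.
have -> : m%:R * theta = m.+1%:R * theta - theta.
  by rewrite -(addn1 m) natrD mulrDl mul1r addrK.
rewrite sinB sinD cos_angle !exprS.
set A := sin _; set B := cos _; set C := s2 ^+ m; set D := sin _.
have := s2E; rewrite expr2 => s22.
have -> : 2 * (s2 * C * A) = s2 * s2 * (s2 * C * A) by rewrite s22.
have -> : 2%:~R * (2 * (C * (A * (s2 / 4) - B * D)))
    = (s2 * s2) * (2 * (C * (A * (s2 / 4) - B * D))).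
  by rewrite s22.
by field.
Qed.

(** The angle [m * theta] lies within pi e of a multiple of pi, so its sine is at most 4 e in
    absolute value. *)
Lemma lucasU_le (m : nat) (p : int) (e : R) :
  `|m%:R * (theta / pi) - p%:~R| <= e ->
  7 * (lucasU m)%:~R ^+ 2 <= 64 * e ^+ 2 * 2 ^+ m :> R.
Proof.
move=> le_e; have pi_gt0 := pi_gt0 R; have := pihalf_lt2 R => pi4.
have e_ge0 : 0 <= e := le_trans (normr_ge0 _) le_e.
have sin_le : `|sin (m%:R * theta)| <= 4 * e.
  rewrite -(normr_sinDpi _ p); apply: le_trans (normr_sin_le _) _.
  have -> : m%:R * theta - p%:~R * pi = pi * (m%:R * (theta / pi) - p%:~R).
    by rewrite mulrBr mulrCA (mulrC pi (theta / pi)) divfK ?gt_eqF // (mulrC pi).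
  by rewrite normrM gtr0_norm //; apply: ler_pM => //; [exact: ltW | lra].
rewrite -s7E -exprMn lucasU_sin !exprMn exprAC s2E.
rewrite [leRHS](_ : _ = 2 ^+ 2 * (2 ^+ m * (4 * e) ^+ 2)); last by ring.
rewrite !ler_pM2l ?exprn_gt0 // -real_normK ?num_real //.
by rewrite lerXn2r // ?nnegrE // mulr_ge0.
Qed.

End Angle.

(** [D] is a Dirichlet denominator of theta / pi, and [m] the odd denominator derived from it, with
    error at most 2 / D; this turns 64 e^2 into 256 / D^2. *)
Lemma lucasU_small (R : realType) (B : nat) : exists m D : nat,
  [/\ odd m, (m <= D)%N, (B <= D)%N & 7 * lucasU m ^+ 2 * D%:Z ^+ 2 <= 256 * 2 ^+ m].
Proof.
pose x : R := acos ((Num.sqrt 2)^-1 / 2) / pi.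
pose Q := (2 ^ B.+2)%N; have Q_gt0 : (0 < Q)%N by rewrite expn_gt0.
have [d [p [dQ cop_dp lt_x]]] := dirichlet_approximation x Q_gt0.
have d_gt0 : (0 < d)%N by case/andP: dQ.
(* The denominator cannot be small: [lucasU d] is a nonzero integer, so an error below 1/Q forces 7
   Q^2 <= 64 * 2^d. *)
have leBd : (B <= d)%N.
  have U_neq0 : lucasU d != 0.
    by case: d d_gt0 {dQ cop_dp lt_x} => // d _; exact: lucasU_neq0.
  have := lucasU_le (ltW lt_x).
  rewrite exprVn => le_U.
  have : 7 * Q%:R ^+ 2 <= 64 * 2 ^+ d :> R.
    have QR : 0 < Q%:R ^+ 2 :> R by rewrite exprn_gt0 // ltr0n.
    rewrite mulrAC ler_pdivlMr // in le_U; apply: le_trans le_U.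
    rewrite ler_pM2r // ler_peMr // -rmorphXn ler1z.
    by rewrite -gtz0_ge1 exprn_even_gt0.
  rewrite /Q -!natrX -!natrM ler_nat -expnM => le2.
  rewrite -(leq_exp2l (m := 2)) //; have : (2 ^ B <= 2 ^ (B.+2 * 2) %/ 16)%N.
    by rewrite (_ : B.+2 * 2 = B * 2 + 4)%N ?expnD ?mulnK // ?leq_exp2l //; lia.
  lia.
have [m [r [odd_m le_md le_x]]] := odd_denominator dQ cop_dp lt_x.
exists m, d; split=> //.
have dR : 0 < d%:R ^+ 2 :> R by rewrite exprn_gt0 // ltr0n.
rewrite -(ler_int R) !intrM !rmorphXn /=.
have := lucasU_le le_x; rewrite exprMn exprVn.
have -> : 64 * (2 ^+ 2 * (d%:R ^+ 2)^-1) * 2 ^+ m = 256 * 2 ^+ m / d%:R ^+ 2 :> R by ring.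
by rewrite ler_pdivlMr.
Qed.

(** * Norm equation and residues modulo powers of 7 *)

(* Z[a] with a ^+ 2 - a + 2 = 0 is norm-Euclidean and 2 = a (1 - a) splits in it. *)
Lemma norm_form_pow2 (n : nat) (x y : int) :
  x ^+ 2 + x * y + 2 * y ^+ 2 = 2 ^+ n ->
  exists (s : bool) (c : nat), (c <= n)%N /\
    forall (K : comNzRingType) (a : K), a ^+ 2 - a + 2 = 0 ->
      x%:~R + y%:~R * a = (-1) ^+ s * (a ^+ c * (1 - a) ^+ (n - c)).
Proof.
elim: n x y => [|n IHn] x y normE.
  (* Four times the form is (2 x + y)^2 + 7 y^2, which must equal 4 here. *)
  have y0 : y = 0 by nia.
  have : x = 1 \/ x = -1 by nia.
  rewrite y0 => -[] ->; [exists false | exists true]; exists 0%N; split=> // K a _;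
    by rewrite mul0r addr0 !expr0 !mulr1 ?expr1 ?rmorphN.
rewrite (exprS 2 n) in normE.
have [x_even | x_odd] := boolP (2 %| x)%Z.
  have /dvdzP[k xk] := x_even; rewrite mulrC in xk; subst x.
  (* For x = 2 k the element is divisible by a: x + y a = a ((y + k) - k a). *)
  have [|s [c [le_cn xyE]]] := IHn (y + k) (- k).
    by apply: (@mulfI _ (2 : int)) => //; rewrite -normE; ring.
  exists s, c.+1; split=> // K a aE; rewrite subSS exprS -mulrA mulrCA -xyE //.
  apply/eqP; rewrite -subr_eq0; apply/eqP.
  rewrite -[RHS](mulr0 k%:~R) -aE rmorphD rmorphN rmorphM /=; ring.
(* For odd x the even norm forces x + y = 2 k, and the other prime over 2 divides: x + y a = (1 - a)
   (- y + k a). *)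
have /dvdzP[k xk] : (2 %| x + y)%Z.
  have : (2 %| x * (x + y))%Z.
    by apply/dvdzP; exists (2 ^+ n - y ^+ 2); rewrite mulrBl (mulrC (2 ^+ n)) -normE; ring.
  by rewrite !dvdzE abszM Euclid_dvdM // -!dvdzE (negPf x_odd).
have [|s [c [le_cn xyE]]] := IHn (- y) k.
  have xE : x = k * 2 - y by rewrite -xk addrK.
  by apply: (@mulfI _ (2 : int)) => //; rewrite -normE xE; ring.
exists s, c; split=> [|K a aE]; first exact: leqW.
rewrite subSn // (exprS (1 - a)) (mulrCA (a ^+ c) (1 - a)) (mulrCA ((-1) ^+ s)) -xyE //.
have -> : x = k * 2 - y by rewrite -xk addrK.
apply/eqP; rewrite -subr_eq0; apply/eqP.
rewrite -[RHS](mulr0 k%:~R) -aE rmorphB rmorphN rmorphM /=; ring.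
Qed.

(* The sign is detected by the ring morphism to F_7 sending a to 4. *)
Lemma norm_form_pow2_sign (n : nat) (x y : int) :
  x ^+ 2 + x * y + 2 * y ^+ 2 = 2 ^+ n -> (x + 4 * y = -1 %[mod 7])%Z ->
  exists c : nat, (c <= n)%N /\
    forall (K : comNzRingType) (a : K), a ^+ 2 - a + 2 = 0 ->
      x%:~R + y%:~R * a = - (a ^+ c * (1 - a) ^+ (n - c)).
Proof.
move=> /norm_form_pow2[s [c [le_cn xyE]]] mod7; exists c; split=> // K a aE.
rewrite xyE //; case: s xyE => [|xyE]; first by rewrite mulN1r.
(* Both 4 and 1 - 4 equal 4 in F_7, so the positive sign would give -1 = 4^n, but the powers of 4
   are 1, 2 and 4. *)
have four : (4 : 'F_7) ^+ 2 - 4 + 2 = 0 by apply/eqP.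
exfalso; have := xyE _ _ four.
have -> : 1 - 4 = 4 :> 'F_7 by apply/eqP.
rewrite -exprD subnKC // mul1r.
have -> : x%:~R + y%:~R * 4 = (x + 4 * y)%:~R :> 'F_7 by rewrite rmorphD rmorphM /= mulrC.
have -> : (x + 4 * y)%:~R = -1 :> 'F_7.
  have /dvdzP[k kE] : (7 %| x + 4 * y - (-1))%Z by rewrite -eqz_mod_dvd; apply/eqP.
  rewrite -[x + _](subrK (-1)) kE rmorphD rmorphM /= (_ : 7%:~R = 0 :> 'F_7) ?mulr0 ?add0r //.
  by apply/eqP.
have : (4 : 'F_7) ^+ n \in [:: 1; 2; 4].
  elim: n {xyE le_cn} => // n; rewrite exprS !inE => /or3P[] /eqP-> //.
by rewrite !inE => /or3P[] /eqP->.
Qed.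

(** * Functions modulo a power of 7 that are invariant under doubling *)

Lemma exp8_mod (r w : nat) : (8 ^ (7 ^ r * w) = 1 + 7 ^ r.+1 * w %[mod 7 ^ r.+2])%N.
Proof.
(* Raising 1 + 7^(r+1) A to the 7th power gains exactly one factor 7 and keeps A modulo 7. *)
have [A [AE A1]] : exists A, (8 ^ 7 ^ r = 1 + 7 ^ r.+1 * A)%N /\ (A = 1 %[mod 7])%N.
  elim: r => [|r [A [AE A1]]]; first by exists 1%N.
  pose Y := (7 ^ r.+1 * A)%N.
  have YE : ((1 + Y) ^ 7 = 1 + 7 * Y + 21 * Y ^ 2
      + Y ^ 3 * (35 + 35 * Y + 21 * Y ^ 2 + 7 * Y ^ 3 + Y ^ 4))%N by ring.
  move: (35 + _ + _ + _ + _)%N YE => C YE.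
  exists (A + 7 * (3 * 7 ^ r * A * A + 7 ^ r * 7 ^ r * A * A * A * C))%N; split.
    by rewrite expnSr expnM AE YE /Y !(expnS 7); move: (7 ^ r)%N => X; ring.
  by rewrite mulnC addnC modnMDl.
rewrite expnM AE.
elim: w => [|w IHw]; first by rewrite muln0.
rewrite expnS -modnMmr IHw modnMmr.
have [B BE] : exists B, (A = 1 + 7 * B \/ A + 7 * B = 1)%N.
  exists (A %/ 7)%N; left; rewrite {1}(divn_eq A 7) A1; lia.
have {BE}BE : A = (1 + 7 * B)%N.
  case: BE => // ?; have : A != 0%N by apply: contra_eq_neq A1 => ->.
  lia.
rewrite BE.
have -> : ((1 + 7 ^ r.+1 * (1 + 7 * B)) * (1 + 7 ^ r.+1 * w)
  = (B + 7 ^ r * w * (1 + 7 * B)) * 7 ^ r.+2 + (1 + 7 ^ r.+1 * w.+1))%N.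
  rewrite !expnS; move: (7 ^ r)%N => X; ring.
by rewrite modnMDl.
Qed.

Lemma sum_split_mod (V : nmodType) (q m : nat) (h : nat -> V) :
  \sum_(0 <= j < q * m) h j = \sum_(0 <= a < q) \sum_(0 <= r < m) h (a + q * r)%N.
Proof.
rewrite exchange_big /=; elim: m => [|m IHm]; first by rewrite muln0 !big_geq.
rewrite big_nat_recr //= -IHm mulnSr (@big_cat_nat _ _ _ (q * m)) ?leq_addr //=.
congr (_ + _); rewrite -{1}[(q * m)%N]add0n big_addn addKn.
by apply: eq_bigr.
Qed.

Section DoublingInvariant.
Variables (i : nat) (c : nat -> int).
Hypothesis c_mod : forall j k, (j = k %[mod 7 ^ i.+1])%N -> c j = c k.
Hypothesis c_double : forall j, c (2 * j)%N = c j.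

Lemma doubling_invariant_exp8 l j : c (8 ^ l * j)%N = c j.
Proof.
elim: l => [|l IHl]; first by rewrite mul1n.
by rewrite expnS (_ : 8 = 2 * (2 * 2))%N // -!mulnA !c_double.
Qed.

(* The powers of 8 run through all residues 1 mod 7 modulo 7 ^ i.+1. *)
Lemma doubling_invariant_shift j : ~~ (7 ^ i %| j)%N -> c (j + 7 ^ i)%N = c j.
Proof.
move=> ndvd; have j_gt0 : (0 < j)%N by case: j ndvd; rewrite ?dvdn0.
have [//|u u7 jE] := @pfactor_coprime 7 j _ j_gt0.
set e := logn 7 j in jE.
have lt_ei : (e < i)%N.
  by rewrite ltnNge; apply: contra ndvd => le_ie; rewrite jE dvdn_mull // dvdn_exp2l.
have [r iE] : exists r, i = (r.+1 + e)%N by exists (i - e).-1; lia.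
(* By Fermat, u^5 is inverse to u modulo 7. Multiplying j = u 7^e by 8^(7^r w) then adds 7^i u w,
   which is 7^i modulo 7^(i+1). *)
have [w uw] : exists w, (u * w = 1 %[mod 7])%N.
  have u7' : (u %% 7)%N != 0%N by rewrite prime_coprime // in u7.
  exists (u ^ 5)%N; rewrite -expnS -modnXm.
  have : (u %% 7 < 7)%N by rewrite ltn_mod.
  by case: (u %% 7)%N u7' => [|[|[|[|[|[|[|]]]]]]].
rewrite -[RHS](doubling_invariant_exp8 (7 ^ r * w)); apply: c_mod.
have E : (8 ^ (7 ^ r * w) * j = (1 + 7 ^ r.+1 * w) * j %[mod 7 ^ i.+1])%N.
  by rewrite iE jE !mulnA -addSn expnD -!muln_modl -[(_ * u %% _)%N]modnMml exp8_mod modnMml.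
rewrite E mulnDl mul1n.
have -> : (7 ^ r.+1 * w * j = 7 ^ i * (u * w))%N by rewrite iE jE expnD; ring.
apply/eqP; rewrite eqn_modDl expnSr -[X in X == _ %[mod _]]muln1.
by rewrite -!muln_modr uw.
Qed.

(** On each class a + 7^i Z with 0 < a < 7^i the coefficients are constant, so the vanishing sum of
    powers of [z ^+ (7 ^ i)] removes it; only the multiples of 7^i survive. *)
Lemma doubling_invariant_sum (K : comNzRingType) (z : K) :
  \sum_(0 <= r < 7) (z ^+ (7 ^ i)) ^+ r = 0 ->
  \sum_(0 <= j < 7 ^ i.+1) (c j)%:~R * z ^+ j
    = \sum_(0 <= r < 7) (c (7 ^ i * r)%N)%:~R * (z ^+ (7 ^ i)) ^+ r.
Proof.
move=> sum0; rewrite expnSr sum_split_mod big_ltn ?expn_gt0 //.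
rewrite [X in _ + X]big_nat [X in _ + X]big1 ?addr0 => [|a /andP[a_gt0 lt_a]].
  by apply: eq_bigr => r _; rewrite add0n exprM.
rewrite -[RHS](mulr0 ((c a)%:~R * z ^+ a)) -[in RHS]sum0 mulr_sumr.
apply: eq_bigr => r _; rewrite exprD exprM mulrA; congr (_%:~R * _ * _).
elim: r => [|r IHr]; first by rewrite muln0 addn0.
rewrite mulnSr addnA doubling_invariant_shift //.
by rewrite dvdn_addl ?dvdn_mulr // gtnNdvd.
Qed.

End DoublingInvariant.

(** * Gauss sums in characteristic 2 *)

Lemma finField_prim_root (F : finFieldType) : exists g : F, (#|F|.-1).-primitive_root g.
Proof.
have card_gt1 := finNzRing_gt1 F.
pose rs := enum (predC1 (0 : F)).
have /hasP[g _ prim_g] : has (#|F|.-1).-primitive_root rs; last by exists g.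
apply: has_prim_root; rewrite ?enum_uniq //; first by case: #|F| card_gt1 => [|[]].
  apply/allP => x; rewrite mem_enum !inE => x_neq0; apply/unity_rootP.
  apply: (mulfI x_neq0); rewrite -exprS prednK ?expf_card ?mulr1 //.
  exact: ltnW.
by rewrite -cardE cardC1.
Qed.

(** In characteristic 2 additive characters only take the values 1 and -1, so integer values
    suffice. *)
Definition addchar (F : zmodType) (lam : F -> int) :=
  lam 0 = 1 /\ {morph lam : x y / x + y >-> x * y}.

Section GaussSums.
Variables (F : finFieldType) (n : nat) (g : F).
Hypothesis charF : 2 \in [pchar F].
Hypothesis cardF : #|F| = (2 ^ n)%N.
Hypothesis odd_n : odd n.
Hypothesis prim_g : (#|F|.-1).-primitive_root g.

Definition trace (x : F) : F := \sum_(i < n) x ^+ (2 ^ i).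

Lemma traceD : {morph trace : x y / x + y}.
Proof.
move=> x y; rewrite -big_split; apply: eq_bigr => i _ /=.
by rewrite exprDn_pchar // pnatX (eq_pnat _ (pcharf_eq charF)) pnat_id.
Qed.

Lemma trace_sqr x : trace (x ^+ 2) = trace x.
Proof.
rewrite /trace; move: odd_n cardF; case: n => // k _ cardFk.
under eq_bigr do rewrite -exprM -expnS.
rewrite big_ord_recr [RHS]big_ord_recl /= addrC -cardFk expf_card expr1; congr (_ + _).
Qed.

Lemma trace_idem x : trace x ^+ 2 = trace x.
Proof.
have sumX (r : seq 'I_n) :
    (\sum_(i <- r) x ^+ (2 ^ i)) ^+ 2 = \sum_(i <- r) (x ^+ 2) ^+ (2 ^ i).
  elim: r => [|i r IHr]; first by rewrite !big_nil expr0n.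
  by rewrite !big_cons sqrrD IHr mulr2n addrr_pchar2 // addr0 -!exprM mulnC.
by rewrite -[in RHS]trace_sqr /trace sumX.
Qed.

Lemma trace_cases x : trace x = 0 \/ trace x = 1.
Proof.
have /eqP := trace_idem x; rewrite expr2 -{3}(mulr1 (trace x)) -subr_eq0 -mulrBr.
by rewrite mulf_eq0 subr_eq0 => /orP[] /eqP; [left | right].
Qed.

(** The canonical additive character (-1)^Tr(x), with the trace kept inside [F], where it is 0 or
    1. *)
Definition psi (x : F) : int := if trace x == 0 then 1 else -1.

Lemma psi_addchar : addchar psi.
Proof.
have tr0 : trace 0 = 0 by apply: (addIr (trace 0)); rewrite -traceD !add0r.
split=> [|x y]; rewrite /psi ?tr0 ?eqxx // traceD.
case: (trace_cases x) => ->; case: (trace_cases y) => ->;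
  by rewrite ?add0r ?addr0 ?addrr_pchar2 ?eqxx ?oner_eq0.
Qed.

Lemma psi_sqr x : psi (x ^+ 2) = psi x.
Proof. by rewrite /psi trace_sqr. Qed.

(** The trace of 1 is n, which is odd. *)
Lemma psi1 : psi 1 = -1.
Proof.
rewrite /psi /trace; under eq_bigr do rewrite expr1n.
rewrite sumr_const card_ord -(odd_double_half n) odd_n -addnn mulrnDr mulrnDr.
by rewrite addrr_pchar2 // addr0 oner_eq0.
Qed.

Lemma addchar_sqr (lam : F -> int) x : addchar lam -> lam x * lam x = 1.
Proof. by move=> [lam0 lamD]; rewrite -lamD addrr_pchar2. Qed.

Lemma sum_addchar (lam : F -> int) : addchar lam ->
  \sum_x lam x = 0 \/ forall x, lam x = 1.
Proof.
move=> [lam0 lamD].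
have [/forallP h|/forallPn[u lam_u]] := boolP [forall x, lam x == 1].
  by right=> x; apply/eqP.
left; set S := \sum_x _; have : S = lam u * S.
  rewrite {1}/S (reindex_inj (addIr u)) mulr_sumr; apply: eq_bigr => x _.
  by rewrite lamD mulrC.
move/eqP; rewrite -{1}(mul1r S) -subr_eq0 -mulrBl mulf_eq0 subr_eq0 eq_sym.
by rewrite (negPf lam_u) => /eqP.
Qed.

Lemma sum_psi_mul y : \sum_x psi (y * x) = if y == 0 then #|F|%:R else 0.
Proof.
have [psi0 psiD] := psi_addchar.
case: eqVneq => [->|y_neq0].
  by under eq_bigr do rewrite mul0r psi0; rewrite sumr_const.
have [|//|/(_ y^-1)] := @sum_addchar (fun x => psi (y * x)).
  by split=> [|x z]; rewrite ?mulr0 // mulrDr psiD.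
by rewrite mulfV // psi1.
Qed.

Lemma addchar_psi (lam : F -> int) : addchar lam ->
  (forall x, lam x = 1) \/ exists2 y, y != 0 & forall x, lam x = psi (y * x).
Proof.
move=> lamP; have [psi0 psiD] := psi_addchar.
(* The correlations of [lam] with all characters [psi (y * x)] sum to [#|F|], so one of them is
   nonzero, and then the product character is trivial. *)
have [y lamy] : exists y, \sum_x lam x * psi (y * x) != 0.
  apply/existsP; apply: contraT => /existsPn h.
  have : \sum_y \sum_x lam x * psi (y * x) = #|F|%:R.
    rewrite exchange_big (bigD1 0) //= [X in _ + X]big1 => [|x x_neq0].
      by under eq_bigr do rewrite mulr0 psi0 (proj1 lamP); rewrite sumr_const addr0.
    rewrite -mulr_sumr; under eq_bigr do rewrite mulrC.
    by rewrite sum_psi_mul (negPf x_neq0) mulr0.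
  rewrite big1 => [/esym/eqP|y _]; last by apply/eqP/negPn/h.
  by rewrite pnatr_eq0 cardF expn_eq0.
have [||lamE] := @sum_addchar (fun x => lam x * psi (y * x)).
- have [lam0 lamD] := lamP.
  by split=> [|x z]; rewrite ?mulr0 ?lam0 ?psi0 // mulrDr lamD psiD mulrACA.
- by move=> h; rewrite h eqxx in lamy.
have lam_psi x : lam x = psi (y * x).
  by rewrite -[LHS]mulr1 -(addchar_sqr (y * x) psi_addchar) mulrA lamE mul1r.
have [y0|y_neq0] := eqVneq y 0; last by right; exists y.
by left=> x; rewrite lam_psi y0 mul0r psi0.
Qed.

Let N := #|F|.-1.

Let N_gt0 : (0 < N)%N. Proof. exact: prim_order_gt0 prim_g. Qed.

Definition logF (x : F) : nat := if [pick i : 'I_N | g ^+ i == x] is Some i then i else 0.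

Let g_neq0 : g != 0.
Proof.
apply: contra_eq_neq (prim_expr_order prim_g) => ->.
by rewrite expr0n gtn_eqF // eq_sym oner_eq0.
Qed.

Lemma logFK x : x != 0 -> g ^+ logF x = x.
Proof.
move=> x_neq0; rewrite /logF; case: pickP => [i /eqP //|no_i].
have [|i xE] := @prim_rootP _ _ _ prim_g x; last by have := no_i i; rewrite xE eqxx.
apply: (mulfI x_neq0); rewrite -exprS /N prednK ?expf_card ?mulr1 //.
exact: ltnW (finNzRing_gt1 F).
Qed.

Lemma logFM x y : x != 0 -> y != 0 -> (logF (x * y)%R = logF x + logF y %[mod N])%N.
Proof.
move=> x_neq0 y_neq0; apply/eqP; rewrite -(eq_prim_root_expr prim_g) exprD !logFK //.
by rewrite mulf_neq0.
Qed.

Lemma logF_g : (logF g = 1 %[mod N])%N.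
Proof.
by apply/eqP; rewrite -(eq_prim_root_expr prim_g) logFK.
Qed.

(** For [z] with [z ^+ N = 1] this is the multiplicative character sending [g] to [z], extended by
    0. *)
Definition chi (z : algC) (x : F) : algC := if x == 0 then 0 else z ^+ logF x.

Definition gauss (z : algC) : algC := \sum_x chi z x * (psi x)%:~R.

Section Character.
Variable z : algC.
Hypothesis zN : z ^+ N = 1.

Let z_mod i j : (i = j %[mod N])%N -> z ^+ i = z ^+ j.
Proof. by move=> ij; rewrite -(expr_mod i zN) ij expr_mod. Qed.

Let z_neq0 : z != 0.
Proof.
by apply: contra_eq_neq zN => ->; rewrite expr0n gtn_eqF // eq_sym oner_eq0.
Qed.

Lemma chi0 : chi z 0 = 0. Proof. by rewrite /chi eqxx. Qed.

Lemma chiM x y : chi z (x * y) = chi z x * chi z y.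
Proof.
rewrite /chi mulf_eq0; case: eqVneq => [|x_neq0]; first by rewrite mul0r.
case: eqVneq => [|y_neq0] /=; first by rewrite mulr0.
by rewrite (z_mod (logFM x_neq0 y_neq0)) exprD.
Qed.

Lemma chi_neq0 x : x != 0 -> chi z x != 0.
Proof. by move=> /negPf x_neq0; rewrite /chi x_neq0 expf_neq0. Qed.

Lemma chi1 : chi z 1 = 1.
Proof.
have h := chi_neq0 (oner_neq0 F).
by apply: (mulfI h); rewrite mulr1 -chiM mulr1.
Qed.

Lemma normr_z : `|z| = 1.
Proof.
apply/eqP; rewrite -(pexpr_eq1 (n := N)) //.
by rewrite -normrX zN normr1.
Qed.

Lemma normr_chi x : x != 0 -> `|chi z x| = 1.
Proof. by move=> /negPf x_neq0; rewrite /chi x_neq0 normrX normr_z expr1n. Qed.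

Lemma sum_chi : z != 1 -> \sum_x chi z x = 0.
Proof.
move=> z_neq1.
have chi_g : chi z g = z by rewrite /chi (negPf g_neq0) (z_mod logF_g).
set S := \sum_x _; have : S = z * S.
  rewrite {1}/S (reindex_inj (mulfI g_neq0)) mulr_sumr.
  by apply: eq_bigr => x _; rewrite chiM chi_g.
move/eqP; rewrite -{1}(mul1r S) -subr_eq0 -mulrBl mulf_eq0 subr_eq0 eq_sym.
by rewrite (negPf z_neq1) => /eqP.
Qed.

Lemma gauss_twist y : y != 0 ->
  \sum_x chi z x * (psi (y * x))%:~R = chi z y^-1 * gauss z.
Proof.
move=> y_neq0; rewrite (reindex_inj (mulfI (invr_neq0 y_neq0))) mulr_sumr.
by apply: eq_bigr => x _; rewrite chiM mulVKf // mulrA.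
Qed.

Lemma gauss_norm : z != 1 -> gauss z * (gauss z)^* = (2 ^ n)%:R.
Proof.
move=> z_neq1; have [psi0 psiD] := psi_addchar.
have chi_conj y : y != 0 -> (chi z y)^* = (chi z y)^-1.
  move=> y_neq0; have := normCK (chi z y); rewrite normr_chi // expr1n => h.
  by apply: (mulfI (chi_neq0 y_neq0)); rewrite -h mulfV // chi_neq0.
have -> : (gauss z)^* = \sum_y (chi z y)^* * (psi y)%:~R.
  by rewrite rmorph_sum; apply: eq_bigr => y _; rewrite rmorphM rmorph_int.
rewrite mulr_sumr (bigD1 0) //= chi0 rmorph0 mul0r mulr0 add0r.
(* The substitution x = u y isolates a sum over y of psi((u + 1) y), which is complete up to y = 0
   and singles out u = 1. *)
transitivity (\sum_(y | y != 0) \sum_u chi z u * (psi (u * y + y))%:~R).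
  apply: eq_bigr => y y_neq0; rewrite mulr_suml (reindex_inj (mulIf y_neq0)) /=.
  apply: eq_bigr => u _; rewrite chiM chi_conj // psiD rmorphM /=.
  by field; exact: chi_neq0.
rewrite exchange_big /=.
transitivity (\sum_u chi z u * ((if u == 1 then (2 ^ n)%:R else 0) - 1)).
  apply: eq_bigr => u _; rewrite -mulr_sumr; congr (_ * _).
  have : \sum_y (psi ((u + 1) * y))%:~R = if u == 1 then (2 ^ n)%:R else 0 :> algC.
    rewrite -rmorph_sum sum_psi_mul /= addr_eq0 (oppr_pchar2 charF) cardF.
    by case: ifP => _; rewrite ?rmorph_nat ?rmorph0.
  rewrite (bigD1 0) //= mulr0 psi0 rmorph1 => <-; rewrite addrAC subrr add0r.
  by apply: eq_bigr => y _; rewrite mulrDl mul1r.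
under eq_bigr do rewrite mulrBr mulr1.
rewrite sumrB sum_chi // subr0 (bigD1 1) //= eqxx chi1 mul1r big1 ?addr0 // => u.
by move=> /negPf ->; rewrite mulr0.
Qed.

End Character.
End GaussSums.

Lemma sum_prim_root7 (K : idomainType) (w : K) : w ^+ 7 = 1 -> w != 1 ->
  \sum_(0 <= r < 7) w ^+ r = 0.
Proof.
move=> w7 w_neq1; rewrite big_mkord; apply/eqP.
have : (w - 1) * \sum_(i < 7) w ^+ i == 0 by rewrite -subrX1 w7 subrr.
by rewrite mulf_eq0 subr_eq0 (negPf w_neq1).
Qed.

Lemma prim_root_neq1 (K : nzRingType) (m : nat) (z : K) :
  (1 < m)%N -> m.-primitive_root z -> z != 1.
Proof.
move=> m_gt1 prim_z; rewrite -[z in z != _]expr1 -(expr0 z).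
by rewrite (eq_prim_root_expr prim_z) mod0n modn_small.
Qed.

(** * Gauss sums of characters of order a power of 7 *)

Section GaussValue.
Variables (F : finFieldType) (n : nat) (g : F) (i : nat).
Hypothesis charF : 2 \in [pchar F].
Hypothesis cardF : #|F| = (2 ^ n)%N.
Hypothesis odd_n : odd n.
Hypothesis prim_g : (#|F|.-1).-primitive_root g.
Hypothesis dvd_N : (7 ^ i.+1 %| #|F|.-1)%N.

Let v := (7 ^ i.+1)%N.
Let v_gt0 : (0 < v)%N. Proof. by rewrite expn_gt0. Qed.

Definition class_sum (j : nat) : int :=
  \sum_(x : F | (x != 0) && (logF g x == j %[mod v])) psi n x.

Lemma class_sum_mod j k : (j = k %[mod v])%N -> class_sum j = class_sum k.
Proof. by move=> jk; apply: eq_bigl => x; rewrite jk. Qed.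

(** Squaring permutes the field, preserves [psi] and doubles logarithms; as [v] is odd, the factor 2
    can be cancelled modulo [v]. *)
Lemma class_sum_double j : class_sum (2 * j) = class_sum j.
Proof.
have sqr_inj : injective (fun x : F => x ^+ 2).
  by move=> x y /eqP; rewrite eqf_sqr (oppr_pchar2 charF) orbb => /eqP.
rewrite /class_sum (reindex_inj sqr_inj) /=.
apply: eq_big => [x|x _]; last by rewrite (psi_sqr cardF odd_n).
rewrite expf_eq0 /=; have [//|x_neq0] := eqVneq x 0; rewrite /=.
have -> : (logF g (x ^+ 2)%R = 2 * logF g x %[mod v])%N.
  rewrite expr2 mul2n -addnn -[LHS](modn_dvdm _ dvd_N) (logFM prim_g) //.
  by rewrite modn_dvdm.
apply/eqP/eqP => [h|h]; last by rewrite -modnMmr h modnMmr.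
have odd_v : odd v by rewrite oddX.
have E k : (v./2.+1 * (2 * k) = k * v + k)%N.
  rewrite mulnCA mulnA -{2}(odd_double_half v) odd_v; lia.
have := congr1 (fun u => v./2.+1 * u %% v)%N h.
by rewrite !modnMmr !E !modnMDl.
Qed.

Lemma sum_class_sum (K : comNzRingType) (z : K) : z ^+ v = 1 ->
  \sum_(x : F | x != 0) z ^+ logF g x * (psi n x)%:~R
    = \sum_(0 <= j < v) (class_sum j)%:~R * z ^+ j.
Proof.
move=> zv; rewrite big_mkord.
rewrite (partition_big (fun x => Ordinal (ltn_pmod (logF g x) v_gt0)) xpredT) //=.
apply: eq_bigr => j _; rewrite rmorph_sum mulr_suml.
have jv : (j %% v = j)%N by rewrite modn_small.
apply: eq_big => [x|x /andP[_ /eqP jE]]; first by rewrite -val_eqE /= jv.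
by rewrite -jE /= expr_mod // mulrC.
Qed.

Lemma sum_psi_neq0 : \sum_(x : F | x != 0) psi n x = -1.
Proof.
have := sum_psi_mul charF cardF odd_n 1; rewrite oner_eq0 (bigD1 0) //= mulr0.
rewrite (proj1 (psi_addchar charF cardF odd_n)) => /eqP; rewrite addrC addr_eq0 => /eqP <-.
by apply: eq_bigr => x _; rewrite mul1r.
Qed.

(* [gauss z] is the value at a primitive 7th root of unity of an element of
   Z[zeta_7] fixed by zeta_7 -> zeta_7^2, hence lies in Z[(1 + sqrt(-7)) / 2]. *)
Lemma gauss_value (z : algC) : v.-primitive_root z -> exists (a : algC) (c : nat),
  [/\ a ^+ 2 - a + 2 = 0, a^* = 1 - a, (c <= n)%N
    & gauss n g z = - (a ^+ c * (1 - a) ^+ (n - c))].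
Proof.
move=> prim_z; have zv := prim_expr_order prim_z.
have zN : z ^+ #|F|.-1 = 1.
  by have /dvdnP[k ->] := dvd_N; rewrite mulnC exprM zv expr1n.
have z_neq1 : z != 1.
  by apply: prim_root_neq1 prim_z; rewrite /v (ltn_exp2l 0).
pose w := z ^+ (7 ^ i).
have w7 : w ^+ 7 = 1 by rewrite -exprM -expnSr.
have w_neq1 : w != 1.
  have := @dvdn_prim_root _ _ _ prim_z 7.
  rewrite /v expnSr mulnK // => h.
  by apply: (@prim_root_neq1 _ 7) => //; apply: h; rewrite dvdn_mull.
have sum_w := sum_prim_root7 w7 w_neq1.
(* Doubling has the orbits {0}, {1, 2, 4} and {3, 5, 6} modulo 7, so only [C 0], [C 1] and [C 3]
   remain. *)
pose C r := class_sum (7 ^ i * r).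
have C2 r : C (2 * r)%N = C r by rewrite /C mulnCA class_sum_double.
have C2E : C 2 = C 1 := C2 1.
have C4E : C 4 = C 1 by rewrite (C2 2) C2E.
have C6E : C 6 = C 3 := C2 3.
have C5E : C 5 = C 3.
  rewrite -C6E -(C2 6); apply: class_sum_mod.
  by rewrite (_ : 2 * 6 = 7 + 5)%N // mulnDr -expnSr modnDl.
have gaussE : gauss n g z = \sum_(0 <= r < 7) (C r)%:~R * w ^+ r.
  rewrite -(doubling_invariant_sum class_sum_mod class_sum_double sum_w).
  rewrite -sum_class_sum // /gauss (bigD1 0) //= chi0 mul0r add0r.
  by apply: eq_bigr => x x_neq0; rewrite /chi (negPf x_neq0).
(* Up to sign [a] is the quadratic Gaussian period of 7th roots of unity. *)
clearbody w; pose a := - (w + w ^+ 2 + w ^+ 4).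
have w_sum : 1 + w + w ^+ 2 + w ^+ 3 + w ^+ 4 + w ^+ 5 + w ^+ 6 = 0.
  by rewrite -sum_w !big_nat_recr //= big_geq // add0r expr0 expr1.
have aE : a ^+ 2 - a + 2 = 0.
  have -> : a ^+ 2 - a + 2 = 2 * (1 + w + w ^+ 2 + w ^+ 3 + w ^+ 4 + w ^+ 5 + w ^+ 6)
    + w * (w ^+ 7 - 1) by rewrite /a; ring.
  by rewrite w_sum w7 subrr !mulr0 addr0.
have w_conj : w^* = w ^+ 6.
  have w_neq0 : w != 0 by apply: contra_eq_neq w7 => ->; rewrite expr0n eq_sym oner_eq0.
  apply: (mulfI w_neq0); rewrite -normCK -exprS w7.
  suff -> : `|w| = 1 by rewrite expr1n.
  by apply/eqP; rewrite -(pexpr_eq1 (n := 7)) // -normrX w7 normr1.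
have a_conj : a^* = 1 - a.
  rewrite /a rmorphN !rmorphD !rmorphXn /= w_conj.
  apply/eqP; rewrite -subr_eq0; apply/eqP.
  have -> : - (w ^+ 6 + (w ^+ 6) ^+ 2 + (w ^+ 6) ^+ 4) - (1 - - (w + w ^+ 2 + w ^+ 4))
    = - (1 + w + w ^+ 2 + w ^+ 3 + w ^+ 4 + w ^+ 5 + w ^+ 6)
      - (w ^+ 7 - 1) * (w ^+ 5 + w ^+ 3 * (1 + w ^+ 7 + w ^+ 14)) by ring.
  by rewrite w_sum w7 subrr mul0r oppr0 addr0.
pose x := C 0%N - C 3; pose y := C 3 - C 1%N.
have gaussxy : gauss n g z = x%:~R + y%:~R * a.
  rewrite gaussE !big_nat_recr //= big_geq // add0r expr0 expr1 C2E C4E C5E C6E.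
  rewrite /x /y !rmorphB /=; apply/eqP; rewrite -subr_eq0; apply/eqP.
  rewrite -[RHS](mulr0 (C 3)%:~R) -w_sum /a; ring.
have normE : x ^+ 2 + x * y + 2 * y ^+ 2 = 2 ^+ n.
  apply: (@intr_inj algC).
  have := gauss_norm charF cardF odd_n prim_g zN z_neq1.
  rewrite gaussxy natrX; move: x y {gaussxy} => p q.
  rewrite rmorphD rmorphM /= !rmorph_int a_conj => h.
  rewrite !rmorphD !rmorphM !rmorphXn /= -[X in _ = X]h -[RHS]addr0.
  rewrite -(mulr0 (q%:~R ^+ 2)) -aE; ring.
(* The same reduction at z = 1 in F_7, where 1 added seven times is 0, compares x + 4 y with the sum
   of [psi] over nonzero elements. *)
have sum_mod : (x + 4 * y = -1 %[mod 7])%Z.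
  have F7_sum1 : \sum_(0 <= r < 7) ((1 : 'F_7) ^+ (7 ^ i)) ^+ r = 0.
    under eq_bigr do rewrite !expr1n.
    by rewrite sumr_const_nat; apply/eqP.
  have := sum_class_sum (expr1n _ _ : (1 : 'F_7) ^+ v = 1).
  rewrite (doubling_invariant_sum class_sum_mod class_sum_double F7_sum1).
  under eq_bigr do rewrite expr1n mul1r.
  under [in RHS]eq_bigr do rewrite !expr1n mulr1.
  rewrite -!rmorph_sum sum_psi_neq0 !big_nat_recr //= big_geq // add0r.
  rewrite -!/(C _) C2E C4E C5E C6E => h.
  have : (x + 4 * y - (-1))%:~R = 0 :> 'F_7.
    transitivity ((C 0%N + C 1%N + C 1%N + C 3 + C 1%N + C 3 + C 3 - (-1)
        - 7 * C 1%N)%:~R : 'F_7).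
      by congr (_%:~R); rewrite /x /y; ring.
    rewrite rmorphB /= rmorphB /= -h subrr rmorphM /= sub0r.
    by rewrite (_ : 7%:~R = 0 :> 'F_7) ?mul0r ?oppr0 //; apply/eqP.
  by move/eqP; rewrite -(dvdz_pcharf (pchar_Fp (isT : prime 7))) -eqz_mod_dvd => /eqP.
have [c [le_cn valE]] := norm_form_pow2_sign normE sum_mod.
by exists a, c; split=> //; rewrite gaussxy valE.
Qed.

End GaussValue.

(** * Powers of Gauss sums *)

Lemma lucasU_subX (K : comNzRingType) (a : K) (m : nat) : a ^+ 2 - a + 2 = 0 ->
  a ^+ m - (1 - a) ^+ m = (2 * a - 1) * (lucasU m)%:~R.
Proof.
move=> aE.
suff [] : a ^+ m - (1 - a) ^+ m = (2 * a - 1) * (lucasU m)%:~R /\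
  a ^+ m.+1 - (1 - a) ^+ m.+1 = (2 * a - 1) * (lucasU m.+1)%:~R by [].
elim: m => [|m [IH0 IH1]]; first by split; rewrite /lucasU /=; ring.
split=> //; rewrite lucasU_rec rmorphB rmorphM /= mulrBr -IH1 mulrCA -IH0 !exprS.
apply/eqP; rewrite -subr_eq0; apply/eqP.
rewrite -[RHS](mulr0 (a ^+ m - (1 - a) ^+ m)) -aE; ring.
Qed.

Lemma normr_subX (K : numDomainType) (u s d : K) (c : nat) :
  `|u| = 1 -> `|s| = 1 -> `|u - s| <= d -> `|u ^+ c - s ^+ c| <= c%:R * d.
Proof.
move=> u1 s1 le_d; elim: c => [|c IHc]; first by rewrite !expr0 subrr normr0 mul0r.
rewrite !exprS -addn1 natrD mulrDl mul1r [leRHS]addrC.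
have -> : u * u ^+ c - s * s ^+ c = (u - s) * u ^+ c + s * (u ^+ c - s ^+ c) by ring.
apply: le_trans (ler_normD _ _) _; rewrite !normrM normrX u1 s1 expr1n mulr1 mul1r.
exact: lerD.
Qed.

(** For |v| = 1 the distance from v to its conjugate is |v - 1| |v + 1|, and one of the two factors
    is at least 1. *)
Lemma unit_close_sign (v d : algC) : `|v| = 1 -> `|v - v^*| <= d ->
  exists s : algC, [/\ s = 1 \/ s = -1 & `|v - s| <= d].
Proof.
move=> v1 le_d.
have vv : v * v^* = 1 by rewrite -normCK v1 expr1n.
have le_prod : `|v - 1| * `|v + 1| <= d.
  have -> : `|v - 1| * `|v + 1| = `|v - v^*|; last by [].
  rewrite -normrM -[RHS]mul1r -[in RHS]v1 -normrM mulrBr vv; congr `|_|; ring.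
have : 2 <= `|v + 1| + `|v - 1|.
  apply: le_trans (ler_normB _ _).
  have -> : v + 1 - (v - 1) = 2 by ring.
  by rewrite normr_nat.
have one_real : (1 : algC) \is Num.real by exact: real1.
case: (real_leP one_real (normr_real (v + 1))) => [ge1 _|lt1 ge2].
  exists 1; split; first by left.
  by apply: le_trans le_prod; rewrite ler_peMr.
exists (-1); split; first by right.
rewrite opprK; apply: le_trans le_prod; rewrite ler_peMl //.
rewrite -(lerD2r `|v + 1|) [leRHS]addrC; apply: le_trans ge2.
by rewrite -[2]/(1 + 1) lerD2l ltW.
Qed.

Section PowerEstimate.
Variables (m D : nat).
Hypothesis odd_m : odd m.
Hypothesis D_gt0 : (0 < D)%N.
Hypothesis small : 7 * lucasU m ^+ 2 * D%:Z ^+ 2 <= 256 * 2 ^+ m.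

Let rt : algC := sqrtC 2.
Let rt_gt0 : 0 < rt. Proof. by rewrite sqrtC_gt0. Qed.
Let rt2 : rt ^+ 2 = 2. Proof. exact: sqrtCK. Qed.

Definition imag_quad (a : algC) := a ^+ 2 - a + 2 = 0 /\ a^* = 1 - a.

Lemma imag_quad_norm a : imag_quad a -> `|a| = rt.
Proof.
move=> [aE a_conj]; apply/eqP; rewrite -(eqrXn2 (n := 2)) ?(ltW rt_gt0) //.
by rewrite normCK a_conj rt2 -subr_eq0 -oppr_eq0 -aE; apply/eqP; ring.
Qed.

Let unit_of a := (a / rt) ^+ m.

Lemma imag_quad_unit a : imag_quad a -> `|unit_of a| = 1.
Proof.
move=> aP; rewrite normrX normf_div (imag_quad_norm aP) (gtr0_norm rt_gt0).
by rewrite mulfV ?gt_eqF // expr1n.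
Qed.

Lemma imag_quad_unit_conj a : imag_quad a -> (unit_of a)^* = unit_of (1 - a).
Proof.
move=> [_ a_conj]; rewrite /unit_of rmorphXn rmorphM fmorphV /= a_conj.
by rewrite (CrealP (gtr0_real rt_gt0)).
Qed.

(** The difference is (2 a - 1) U_m / 2^(m/2) with (2 a - 1)^2 = -7, so [small] bounds its square by
    256 / D^2. *)
Lemma imag_quad_unit_close a : imag_quad a ->
  `|unit_of a - (unit_of a)^*| <= 16 / D%:R.
Proof.
move=> aP; rewrite imag_quad_unit_conj // /unit_of !expr_div_n -mulrBl.
rewrite lucasU_subX; last by case: aP.
have DR : 0 < D%:R :> algC by rewrite ltr0n.
rewrite -(ler_pXn2r (n := 2)) ?nnegrE ?normr_ge0 ?divr_ge0 ?(ltW DR) //.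
rewrite -normrX !exprMn !exprVn -exprM mulnC exprM rt2.
have -> : (2 * a - 1) ^+ 2 = - 7.
  apply/eqP; rewrite -subr_eq0; apply/eqP.
  by rewrite -[RHS](mulr0 4) -(proj1 aP); ring.
have U_ge0 : 0 <= (lucasU m)%:~R ^+ 2 :> algC.
  by rewrite -rmorphXn /= ler0z sqr_ge0.
rewrite mulNr mulNr normrN ger0_norm; last first.
  by rewrite mulr_ge0 ?invr_ge0 ?exprn_ge0 // mulr_ge0.
rewrite ler_pdivrMr ?exprn_gt0 // mulrAC ler_pdivlMr ?exprn_gt0 //.
move: small; rewrite -(ler_int algC) !rmorphM !rmorphXn /=.
by rewrite (_ : 256%:~R = 16 ^+ 2) //; ring.
Qed.

Lemma imag_quad_ex : exists a, imag_quad a.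
Proof.
exists ((1 + 'i * sqrtC 7) / 2); split.
  have i2 : ('i : algC) ^+ 2 = -1 := sqrCi _.
  have s7 : (sqrtC 7 : algC) ^+ 2 = 7 := sqrtCK _.
  have -> : ((1 + 'i * sqrtC 7) / 2) ^+ 2 - (1 + 'i * sqrtC 7) / 2 + 2
    = ('i ^+ 2 * sqrtC 7 ^+ 2 + 7) / 4 :> algC by field.
  by rewrite i2 s7 mulN1r addNr mul0r.
have s7r : (sqrtC 7 : algC)^* = sqrtC 7 by apply/CrealP/ger0_real; rewrite sqrtC_ge0.
rewrite rmorphM rmorphD rmorphM /= rmorph1 conjCi s7r fmorphV rmorph_nat.
by field.
Qed.

(** The only two candidates for [a] are conjugate, so a real sign close to one power is equally
    close to the other. *)
Lemma imag_quad_sign : exists2 s : algC, s = 1 \/ s = -1 &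
  forall a, imag_quad a -> `|unit_of a - s| <= 16 / D%:R.
Proof.
have [a0 a0P] := imag_quad_ex.
have [s [s1 le_s]] := unit_close_sign (imag_quad_unit a0P) (imag_quad_unit_close a0P).
exists s => // a aP.
have : (a - a0) * (a - (1 - a0)) = 0.
  have -> : (a - a0) * (a - (1 - a0)) = (a ^+ 2 - a + 2) - (a0 ^+ 2 - a0 + 2) by ring.
  by rewrite (proj1 aP) (proj1 a0P) subrr.
move/eqP; rewrite mulf_eq0 !subr_eq0 => /orP[] /eqP -> //.
rewrite -imag_quad_unit_conj // -(norm_conjC (_ - s)) rmorphB /= conjCK.
suff -> : s^* = s by [].
by case: s1 => ->; rewrite ?rmorphN rmorph1.
Qed.

(** Each of the n unit factors is within 16 / D of the same sign, so the errors add up to 16 n / D.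
    Oddness of [n] and [m] makes the resulting sign independent of [n] and [c]. *)
Lemma imag_quad_power_approx : exists2 s : algC, s = 1 \/ s = -1 &
  forall a n c, imag_quad a -> odd n -> (c <= n)%N ->
    `|(- (a ^+ c * (1 - a) ^+ (n - c))) ^+ m - s * rt ^+ (n * m)|
      <= 16 * n%:R / D%:R * rt ^+ (n * m).
Proof.
have [s s1 closeP] := imag_quad_sign.
exists (- s) => [|a n c aP odd_n le_cn].
  by case: s1 => ->; [right | left; rewrite opprK].
have aP' : imag_quad (1 - a).
  have [aE a_conj] := aP; split; last by rewrite rmorphB rmorph1 /= a_conj.
  by rewrite -[RHS]aE; ring.
have sE k : odd k -> s ^+ k = s.
  by case: s1 => -> odd_k; rewrite ?expr1n // -signr_odd odd_k expr1.
have norm_s : `|s| = 1 by case: s1 => ->; rewrite ?normrN normr1.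
have uE b : b ^+ m = rt ^+ m * unit_of b.
  by rewrite /unit_of expr_div_n mulrCA mulfV ?mulr1 // expf_neq0 // gt_eqF.
have := closeP _ aP'; have := closeP _ aP.
have := imag_quad_unit aP'; have := imag_quad_unit aP.
have := uE (1 - a); have := uE a; move: (unit_of a) (unit_of (1 - a)) => u w.
move=> aE bE norm_u norm_w close_u close_w.
have -> : (- (a ^+ c * (1 - a) ^+ (n - c))) ^+ m
    = - (rt ^+ (n * m) * (u ^+ c * w ^+ (n - c))).
  rewrite exprNn -signr_odd odd_m expr1 mulN1r; congr (- _).
  rewrite exprMn -!exprM !(mulnC _ m) (exprM a) (exprM (1 - a)) aE bE.
  by rewrite !exprMn mulrACA -exprD subnKC // -exprM.
rewrite mulNr -opprD normrN -[s](sE n odd_n) mulrC -mulrBl normrM.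
rewrite [X in _ * X <= _](ger0_norm (ltW (exprn_gt0 _ rt_gt0))) ler_pM2r ?exprn_gt0 //.
have -> : s ^+ n = s ^+ c * s ^+ (n - c) by rewrite -exprD subnKC.
have -> : u ^+ c * w ^+ (n - c) - s ^+ c * s ^+ (n - c)
  = (u ^+ c - s ^+ c) * w ^+ (n - c) + s ^+ c * (w ^+ (n - c) - s ^+ (n - c)) by ring.
apply: le_trans (ler_normD _ _) _; rewrite !normrM !normrX norm_s expr1n mul1r.
rewrite norm_w expr1n mulr1.
apply: le_trans (lerD (normr_subX c norm_u norm_s close_u)
  (normr_subX (n - c) norm_w norm_s close_w)) _.
by rewrite -mulrDl -natrD subnKC // mulrCA mulrA.
Qed.

End PowerEstimate.

(** * Functions of the discrete logarithm *)

Section Balanced.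
Variable v : nat.
Hypothesis odd_v : odd v.

(** The two halves of the nonzero residues cancel, so the trivial character is absent from the
    Fourier expansion. *)
Definition balanced (j : nat) : int :=
  if (j %% v == 0)%N then 0 else if (j %% v <= v./2)%N then 1 else -1.

Lemma balanced_cases j : balanced j = 0 \/ balanced j ^+ 2 = 1.
Proof. by rewrite /balanced; case: ifP => _; [left | right; case: ifP]. Qed.

Lemma balanced_eq0 j : (balanced j == 0) = (v %| j)%N.
Proof. by rewrite /balanced /dvdn; case: ifP => // _; case: ifP. Qed.

Lemma balanced_mod j : balanced (j %% v) = balanced j.
Proof. by rewrite /balanced modn_mod. Qed.

Lemma sum_balanced : \sum_(0 <= j < v) balanced j = 0.
Proof.
have vE : v = (v./2 + v./2).+1 by lia.
rewrite {1}vE big_nat_recl //= {1}/balanced mod0n eqxx add0r.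
rewrite (@big_cat_nat _ _ _ v./2) ?leq_addr //=.
rewrite [X in X + _](eq_big_nat _ _ (F2 := fun=> 1)) => [|j /andP[_ lt_j]]; last first.
  by rewrite /balanced modn_small ?ifT //=; lia.
rewrite [X in _ + X](eq_big_nat _ _ (F2 := fun=> -1)) => [|j /andP[le_j lt_j]]; last first.
  rewrite /balanced modn_small /=; last lia.
  by rewrite ifN //; lia.
by rewrite !sumr_const_nat subn0 addnK mulNrn subrr.
Qed.

Variable zeta : algC.
Hypothesis prim_zeta : v.-primitive_root zeta.

Let v_gt0 : (0 < v)%N. Proof. exact: odd_gt0. Qed.
Let vC : v%:R != 0 :> algC. Proof. by rewrite pnatr_eq0 -lt0n. Qed.
Let zeta_neq0 : zeta != 0.
Proof.
apply: contra_eq_neq (prim_expr_order prim_zeta) => ->.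
by rewrite expr0n gtn_eqF // eq_sym oner_eq0.
Qed.

Lemma sum_prim_root_expr (j l : nat) :
  \sum_(t < v) (zeta ^+ t) ^+ j / (zeta ^+ t) ^+ l = if (j == l %[mod v])%N then v%:R else 0.
Proof.
pose w := zeta ^+ j / zeta ^+ l.
have wE (t : 'I_v) : (zeta ^+ t) ^+ j / (zeta ^+ t) ^+ l = w ^+ t.
  by rewrite /w expr_div_n -!exprM !(mulnC t).
under eq_bigr do rewrite wE.
rewrite -(eq_prim_root_expr prim_zeta).
case: eqVneq => [jl|ne_jl].
  rewrite /w jl mulfV ?expf_neq0 //.
  by under eq_bigr do rewrite expr1n; rewrite sumr_const card_ord.
have w_neq1 : w != 1.
  apply: contra ne_jl => /eqP w1; apply/eqP.
  by rewrite -[RHS]mul1r -w1 /w divfK // expf_neq0.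
apply/eqP; have : (w - 1) * \sum_(t < v) w ^+ t == 0.
  rewrite -subrX1 /w expr_div_n -!exprM !(mulnC _ v) !exprM.
  by rewrite (prim_expr_order prim_zeta) !expr1n divr1 subrr.
by rewrite mulf_eq0 subr_eq0 (negPf w_neq1).
Qed.

Definition balanced_hat (t : nat) : algC :=
  \sum_(l < v) (balanced l)%:~R / (zeta ^+ t) ^+ l.

Lemma balanced_hat0 : balanced_hat 0 = 0.
Proof.
rewrite /balanced_hat; under eq_bigr do rewrite expr0 expr1n divr1.
by rewrite -rmorph_sum -(big_mkord xpredT balanced) sum_balanced.
Qed.

Lemma normr_balanced_hat t : `|balanced_hat t| <= v%:R.
Proof.
apply: le_trans (ler_norm_sum _ _ _) _.
rewrite -[v in leRHS]card_ord -sumr_const; apply: ler_sum => l _.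
have zeta1 : `|zeta| = 1.
  apply/eqP; rewrite -(pexpr_eq1 (n := v)) //.
  by rewrite -normrX (prim_expr_order prim_zeta) normr1.
rewrite normf_div !normrX zeta1 !expr1n divr1.
by case: (balanced_cases l) => [->|/eqP]; rewrite ?normr0 // sqrf_eq1 => /orP[] /eqP->;
  rewrite ?rmorphN ?normrN normr1.
Qed.

Lemma balanced_inversion j :
  (balanced j)%:~R = v%:R^-1 * \sum_(t < v) balanced_hat t * (zeta ^+ t) ^+ j.
Proof.
apply: (mulfI vC); rewrite mulVKf //.
under eq_bigr do rewrite /balanced_hat mulr_suml.
rewrite exchange_big (bigD1 (Ordinal (ltn_pmod j v_gt0))) //.
have E (l : 'I_v) : \sum_(t < v) (balanced l)%:~R / (zeta ^+ t) ^+ l * (zeta ^+ t) ^+ j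
    = (balanced l)%:~R * (if (j == l %[mod v])%N then v%:R else 0).
  by rewrite -sum_prim_root_expr mulr_sumr; apply: eq_bigr => t _; rewrite mulrAC mulrA.
rewrite E /= modn_mod eqxx balanced_mod mulrC big1 ?addr0 // => l ne_l.
rewrite E ifN ?mulr0 // eq_sym modn_small //.
Qed.

End Balanced.

Lemma prim_root_pow7 (k t : nat) (zeta : algC) : (7 ^ k).-primitive_root zeta ->
  (0 < t < 7 ^ k)%N -> exists2 i, (i < k)%N & (7 ^ i.+1).-primitive_root (zeta ^+ t).
Proof.
move=> prim_zeta /andP[t_gt0 lt_t].
have := exp_prim_root prim_zeta t; set d := (_ %/ _)%N => prim_d.
have d_dvd : (d %| 7 ^ k)%N by rewrite dvdn_div // dvdn_gcdr.
have /(dvdn_pfactor _ _ (isT : prime 7))[e le_ek dE] := d_dvd.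
case: e dE le_ek => [|i] dE lt_ik; last by exists i; rewrite -?dE.
have : zeta ^+ t == 1.
  by have := prim_expr_order prim_d; rewrite dE expr1 => ->.
by rewrite -(expr0 zeta) (eq_prim_root_expr prim_zeta) mod0n modn_small // gtn_eqF.
Qed.

(** * Walsh spectrum and zeros of a function of the sum of logarithms *)

Section Spectrum.
Variables (F : finFieldType) (n k m : nat) (g : F) (zeta : algC).
Hypothesis charF : 2 \in [pchar F].
Hypothesis cardF : #|F| = (2 ^ n)%N.
Hypothesis odd_n : odd n.
Hypothesis prim_g : (#|F|.-1).-primitive_root g.
Hypothesis dvd_N : (7 ^ k %| #|F|.-1)%N.
Hypothesis prim_zeta : (7 ^ k).-primitive_root zeta.

Let v := (7 ^ k)%N.
Let odd_v : odd v. Proof. by rewrite oddX orbT. Qed.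
Let v_gt0 : (0 < v)%N. Proof. exact: odd_gt0. Qed.
Let vC : 0 < v%:R :> algC. Proof. by rewrite ltr0n. Qed.

Let zetaN (t : nat) : (zeta ^+ t) ^+ #|F|.-1 = 1.
Proof.
by have /dvdnP[u ->] := dvd_N; rewrite exprAC mulnC exprM (prim_expr_order prim_zeta) !expr1n.
Qed.

Definition coset_fun (y : 'I_m -> F) : int :=
  if [forall i, y i != 0] then balanced v (\sum_i logF g (y i)) else 0.

Lemma coset_fun_cases y : coset_fun y = 0 \/ coset_fun y ^+ 2 = 1.
Proof. by rewrite /coset_fun; case: ifP => _; [exact: balanced_cases | left]. Qed.

Lemma prod_chi z (y : 'I_m -> F) :
  \prod_i chi g z (y i) = if [forall i, y i != 0] then z ^+ (\sum_i logF g (y i)) else 0.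
Proof.
case: ifP => [/forallP y_neq0|/negbT/forallPn[i yi0]].
  by rewrite -prodrXr; apply: eq_bigr => i _; rewrite /chi (negPf (y_neq0 i)).
by rewrite (bigD1 i) //= /chi (negbNE yi0) mul0r.
Qed.

Lemma coset_funE (y : 'I_m -> F) : (coset_fun y)%:~R
  = v%:R^-1 * \sum_(t < v) balanced_hat v zeta t * \prod_i chi g (zeta ^+ t) (y i).
Proof.
under eq_bigr do rewrite prod_chi; rewrite /coset_fun; case: ifP => _.
  exact: balanced_inversion.
by rewrite big1 ?mulr0 // => t _; rewrite mulr0.
Qed.

Lemma coset_fun_spectrum_expand (lam : 'I_m -> F -> int) :
  (\sum_(y : {ffun 'I_m -> F}) coset_fun y * \prod_i lam i (y i))%:~R
    = v%:R^-1 * \sum_(t < v) balanced_hat v zeta t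
        * \prod_i \sum_x chi g (zeta ^+ t) x * (lam i x)%:~R.
Proof.
rewrite rmorph_sum /=.
under eq_bigr do rewrite rmorphM rmorph_prod /= coset_funE -mulrA mulr_suml.
rewrite -mulr_sumr exchange_big /=; congr (_ * _); apply: eq_bigr => t _.
rewrite bigA_distr_bigA mulr_sumr; apply: eq_bigr => y _.
by rewrite -mulrA -big_split.
Qed.

Lemma coset_fun_spectrum (s e : algC) (lam : 'I_m -> F -> int) :
  (forall i, addchar (lam i)) -> `|s| = 1 -> 0 <= e ->
  (forall t, (0 < t < v)%N ->
    `|gauss n g (zeta ^+ t) ^+ m - s * sqrtC 2 ^+ (n * m)| <= e * sqrtC 2 ^+ (n * m)) ->
  `|(\sum_(y : {ffun 'I_m -> F}) coset_fun y * \prod_i lam i (y i))%:~R|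
    <= (1 + v%:R * e) * sqrtC 2 ^+ (n * m).
Proof.
move=> lamP s1 e_ge0 approx; rewrite coset_fun_spectrum_expand.
have Q_ge0 : 0 <= sqrtC 2 ^+ (n * m) :> algC by rewrite exprn_ge0 // sqrtC_ge0.
have zeta_neq1 (t : 'I_v) : (t : nat) != 0%N -> zeta ^+ t != 1.
  move=> t_neq0; rewrite -(expr0 zeta) (eq_prim_root_expr prim_zeta) mod0n modn_small //.
(* If some [lam i] is trivial the whole sum vanishes: its factor is 0 for t > 0, and the Fourier
   coefficient is 0 for t = 0. *)
have [/existsP[i /forallP lam1]|/existsPn nontriv] :=
    boolP [exists i, [forall x, lam i x == 1]].
  rewrite big1 ?mulr0 ?normr0 => [|t _].
    by rewrite mulr_ge0 // addr_ge0 // mulr_ge0.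
  have [->|t_neq0] := eqVneq (t : nat) 0%N; first by rewrite balanced_hat0 ?mul0r.
  have sum0 : \sum_x chi g (zeta ^+ t) x * (lam i x)%:~R = 0.
    under eq_bigr do rewrite (eqP (lam1 _)) mulr1.
    by rewrite (sum_chi prim_g) ?zetaN ?zeta_neq1.
  by rewrite (bigD1 i) //= sum0 mul0r mulr0.
have [y y_neq0 yP] : exists2 y : 'I_m -> F, forall i, y i != 0
    & forall i x, lam i x = psi n (y i * x).
  apply: (fin_all_exists2 (P := fun i y => y != 0)
    (Q := fun i y => forall x, lam i x = psi n (y * x))) => i.
  have [h|//] := addchar_psi charF cardF odd_n (lamP i).
  by have := nontriv i; rewrite negb_forall => /existsP[x]; rewrite h eqxx.
have SE (t : 'I_v) : \prod_i \sum_x chi g (zeta ^+ t) x * (lam i x)%:~R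
    = \prod_i chi g (zeta ^+ t) (y i)^-1 * gauss n g (zeta ^+ t) ^+ m.
  transitivity (\prod_(i < m) (chi g (zeta ^+ t) (y i)^-1 * gauss n g (zeta ^+ t))).
    apply: eq_bigr => i _; under eq_bigr do rewrite yP.
    by rewrite (gauss_twist _ prim_g) ?zetaN.
  by rewrite big_split /= prodr_const card_ord.
under eq_bigr do rewrite SE.
(* With every Gauss sum power replaced by the common value s Q, Fourier inversion reassembles
   [coset_fun] at the inverted point, a number in {0, 1, -1}. *)
pose E : algC := (coset_fun (fun i => (y i)^-1))%:~R.
have E1 : `|E| <= 1.
  by rewrite /E; case: (coset_fun_cases (fun i => (y i)^-1)) => [->|/eqP];
    rewrite ?normr0 // sqrf_eq1 => /orP[] /eqP->; rewrite ?rmorphN ?normrN normr1.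
set Q := sqrtC 2 ^+ _ in approx Q_ge0 *.
have -> : v%:R^-1 * \sum_(t < v) balanced_hat v zeta t *
      (\prod_i chi g (zeta ^+ t) (y i)^-1 * gauss n g (zeta ^+ t) ^+ m)
    = s * Q * E + v%:R^-1 * \sum_(t < v) balanced_hat v zeta t *
      (\prod_i chi g (zeta ^+ t) (y i)^-1 * (gauss n g (zeta ^+ t) ^+ m - s * Q)).
  rewrite /E coset_funE mulrCA -mulrDr; congr (_ * _).
  rewrite mulr_sumr -big_split; apply: eq_bigr => t _ /=; ring.
apply: le_trans (ler_normD _ _) _; rewrite mulrDl mul1r; apply: lerD.
  by rewrite !normrM s1 mul1r (ger0_norm Q_ge0) ler_piMr.
rewrite normrM normfV normr_nat ler_pdivrMl //.
apply: le_trans (ler_norm_sum _ _ _) _.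
have -> : v%:R * (v%:R * e * Q) = \sum_(t < v) v%:R * (e * Q).
  by rewrite sumr_const card_ord -[RHS]mulr_natl !mulrA.
apply: ler_sum => t _; rewrite !normrM.
have [->|t_neq0] := eqVneq (t : nat) 0%N.
  by rewrite balanced_hat0 // normr0 mul0r mulr_ge0 // mulr_ge0.
apply: ler_pM; rewrite ?mulr_ge0 ?normr_balanced_hat //.
rewrite normr_prod big1 ?mul1r => [|i _]; first by apply: approx; rewrite lt0n t_neq0 ltn_ord.
by rewrite (normr_chi prim_g) ?zetaN ?invr_eq0.
Qed.

(** A zero either has a zero coordinate or has all coordinates nonzero and logarithms summing to 0
    modulo [v]; the latter are exactly a fraction 1/v of the points with nonzero coordinates. *)
Lemma coset_fun_zeros : (0 < m)%N -> (v * #|[pred y : {ffun 'I_m -> F} | coset_fun y == 0]|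
  <= v * (m * #|F| ^ m.-1) + #|F| ^ m)%N.
Proof.
move=> m_gt0; pose A := [pred y : {ffun 'I_m -> F} | [forall i, y i != 0]].
pose B := [pred y : {ffun 'I_m -> F} | (v %| \sum_i logF g (y i))%N].
have cardA : #|A| = (#|F|.-1 ^ m)%N.
  have -> : #|A| = #|[pred y : {ffun 'I_m -> F} | y \in ffun_on (predC1 (0 : F))]|.
    apply: eq_card => y; rewrite -[RHS]/(y \in ffun_on (predC1 (0 : F))).
    apply/idP/ffun_onP => [/forallP h i|h]; first exact: h.
    by apply/forallP => i; exact: h.
  by rewrite (eq_card (B := ffun_on (predC1 (0 : F)))) // card_ffun_on cardC1 card_ord.
have cardAB : (v * #|[predI A & B]| = #|F|.-1 ^ m)%N.
  apply/eqP; rewrite -(eqr_nat algC) natrM natrX; apply/eqP.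
  transitivity (\sum_(y : {ffun 'I_m -> F}) \sum_(t < v) \prod_i chi g (zeta ^+ t) (y i)).
    rewrite -sum1_card natr_sum mulr_sumr [LHS]big_mkcond; apply: eq_bigr => y _.
    under [in RHS]eq_bigr do rewrite prod_chi.
    have -> : (y \in [predI A & B])
      = [forall i, y i != 0] && (v %| \sum_i logF g (y i))%N by [].
    case: [forall i, y i != 0]; last by rewrite /= big1.
    transitivity (\sum_(t < v) (zeta ^+ t) ^+ (\sum_i logF g (y i)) / (zeta ^+ t) ^+ 0).
      by rewrite sum_prim_root_expr // mod0n mulr1.
    by apply: eq_bigr => t _; rewrite expr0 divr1.
  rewrite exchange_big /=.
  transitivity (\sum_(t < v) \prod_(i < m) \sum_x chi g (zeta ^+ t) x).
    by apply: eq_bigr => t _; rewrite bigA_distr_bigA.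
  rewrite (bigD1 (Ordinal v_gt0)) //= [X in _ + X]big1 => [|t t_neq0].
    rewrite addr0 prodr_const card_ord; congr (_ ^+ _).
    rewrite (bigD1 0) //= chi0 add0r.
    under eq_bigr => x x_neq0 do rewrite /chi (negPf x_neq0) expr0 expr1n.
    by rewrite sumr_const cardC1.
  rewrite (bigD1 (Ordinal m_gt0)) //= (sum_chi prim_g) ?mul0r ?zetaN //.
  rewrite -(expr0 zeta) (eq_prim_root_expr prim_zeta) mod0n modn_small //.
have cardU : #|[pred y : {ffun 'I_m -> F} | coset_fun y == 0]|
    = (#|predC A| + #|[predI A & B]|)%N.
  have E (y : {ffun _}) : (coset_fun y == 0) = ~~ A y || B y.
    by rewrite /coset_fun /A /=; case: ifP => _ //=; exact: balanced_eq0.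
  rewrite -(cardID A) addnC; congr (_ + _)%N; apply: eq_card => y.
    change (~~ A y && (coset_fun y == 0) = ~~ A y).
    by rewrite E; case: (A y).
  change ((coset_fun y == 0) && A y = A y && B y).
  by rewrite E; case: (A y); rewrite ?andbF ?andbT.
have cardC : (#|A| + #|predC A| = #|F| ^ m)%N.
  by rewrite cardC card_ffun card_ord.
(* Bernoulli's inequality bounds the number of points with a zero coordinate. *)
have bern : (#|F| ^ m <= #|F|.-1 ^ m + m * #|F| ^ m.-1)%N.
  have : (0 < #|F|)%N by rewrite cardF expn_gt0.
  move: #|F| => q q_gt0; elim: m => // -[|j] IHj.
    by rewrite !expn1 mul1n; lia.
  have le_pred : (q.-1 ^ j.+1 <= q ^ j.+1)%N by rewrite leq_exp2r // leq_pred.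
  have := leq_mul (leqnn q) IHj; rewrite -expnS /= => /leq_trans; apply.
  rewrite (expnS q.-1) mulnDr (mulnCA q j.+1) -expnS.
  have -> : (q * q.-1 ^ j.+1 = q.-1 * q.-1 ^ j.+1 + q.-1 ^ j.+1)%N.
    by rewrite -{1}(prednK q_gt0) mulSn addnC.
  by rewrite -addnA leq_add2l (mulSn j.+1) (expnS q j) leq_add2r -expnS.
rewrite cardU mulnDr cardAB leq_add // ?leq_exp2r // ?leq_pred //.
by rewrite leq_mul2l; apply/orP; right; lia.
Qed.

End Spectrum.

(** * Almost flat functions in odd dimension *)

Lemma F2_coordinates (F : finFieldType) (n : nat) :
  2 \in [pchar F] -> #|F| = (2 ^ n)%N ->
  exists phi : F -> 'rV['F_2]_n, {morph phi : x y / x + y} /\ bijective phi.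
Proof.
move=> charF cardF.
have cardE : logn 2 #|pPrimeCharType charF| = n by rewrite [#|_|]cardF pfactorK.
have := pprimeChar_vectAxiom charF; rewrite cardE => -[v2r lin bij].
exists v2r; split=> // x y.
by have := lin 1 x y; rewrite !scale1r.
Qed.

Lemma dot_mxvec m n (A B : 'M['F_2]_(m, n)) :
  dot (mxvec A) (mxvec B) = \sum_i dot (row i A) (row i B).
Proof.
rewrite /dot pair_big (reindex (fun p : 'I_m * 'I_n => mxvec_index p.1 p.2)) /=.
  by apply: eq_bigr => p _; rewrite !mxvecE !mxE.
have [h hK Kh] := curry_mxvec_bij m n; exists h => [[i j] _|k _].
  by apply: (hK (i, j)).
by have := Kh k; case: (h k) => i j; apply.
Qed.

Lemma sign_sum (I : finType) (d : I -> 'F_2) : sign (\sum_i d i) = \prod_i sign (d i).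
Proof. by apply: (big_morph sign signD sign0). Qed.

(** * Transport from tuples over the field to binary vectors *)

Section Transport.
Variables (F : finFieldType) (m n : nat) (phi : F -> 'rV['F_2]_n).
Hypothesis phiD : {morph phi : x y / x + y}.
Variable phiV : 'rV['F_2]_n -> F.
Hypotheses (phiK : cancel phi phiV) (phiVK : cancel phiV phi).

Definition pack (y : {ffun 'I_m -> F}) : 'rV['F_2]_(m * n) :=
  mxvec (\matrix_i phi (y i)).

Definition unpack (x : 'rV['F_2]_(m * n)) : {ffun 'I_m -> F} :=
  [ffun i => phiV (row i (vec_mx x))].

Lemma packK : cancel pack unpack.
Proof. by move=> y; apply/ffunP => i; rewrite ffunE mxvecK rowK phiK. Qed.

Lemma unpackK : cancel unpack pack.
Proof.
move=> x; rewrite -[RHS]vec_mxK; congr mxvec; apply/row_matrixP => i.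
by rewrite rowK ffunE phiVK.
Qed.

Lemma walsh_unpack (f : {ffun 'I_m -> F} -> int) (a : 'rV['F_2]_(m * n)) :
  walsh (fun x => f (unpack x)) a
    = \sum_y f y * \prod_i sign (dot (row i (vec_mx a)) (phi (y i))).
Proof.
rewrite /walsh (reindex pack) /=; last by exists unpack => ? _; rewrite ?packK ?unpackK.
apply: eq_bigr => y _; rewrite packK -[a in dot a _]vec_mxK dot_mxvec sign_sum.
by congr (_ * _); apply: eq_bigr => i _; rewrite rowK.
Qed.

Lemma card_unpack (P : pred {ffun 'I_m -> F}) :
  #|[pred x | P (unpack x)]| = #|[pred y | P y]|.
Proof.
rewrite -(fintype.card_image (can_inj unpackK)); apply: eq_card => y; rewrite [RHS]inE.
apply/fintype.imageP/idP => [[x]|Py]; first by rewrite inE => ? ->.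
by exists (pack y); rewrite ?inE packK.
Qed.

Lemma addchar_dot (a : 'rV['F_2]_n) : addchar (fun x => sign (dot a (phi x))).
Proof.
have phi0 : phi 0 = 0 by apply: (addIr (phi 0)); rewrite -phiD !add0r.
by split=> [|x y]; [rewrite phi0 dotC dot0 | rewrite phiD dotDr signD].
Qed.

End Transport.

Lemma linear_lt_exp (M c : nat) : exists T, forall t, (T <= t)%N -> (M * (t + c) <= 2 ^ t)%N.
Proof.
exists (2 * (M * (2 + c)))%N => t le_t; pose h := t./2.
have tE : (t = h + h + odd t)%N by rewrite -{1}(odd_double_half t) -addnn addnC.
have h_ge : (M * (2 + c) <= h)%N by rewrite /h; lia.
have lt_h : (h < 2 ^ h)%N by rewrite ltn_expl.
apply: (@leq_trans (h.+1 * h.+1)); last first.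
  apply: (@leq_trans (2 ^ h * 2 ^ h)); first exact: leq_mul.
  by rewrite -expnD leq_exp2l //; lia.
apply: (@leq_trans (M * (2 + c) * h.+1)); last by rewrite leq_mul2r leqW ?orbT.
rewrite -mulnA leq_mul2l; apply/orP; right; rewrite tE mulnDl mulnS.
have : (c <= c * h.+1)%N by rewrite leq_pmulr.
by case: (odd t); lia.
Qed.

(** [D] is chosen first and [n] is then of order log D: large enough for 2^n to dominate m <= D, yet
    small enough for D to dominate n. *)
Lemma parameters (R : realType) (a A : nat) : exists n m D : nat,
  [/\ odd n, odd m & (7 ^ a.+1 %| (2 ^ n).-1)%N] /\
  [/\ (0 < D)%N, (16 * 7 ^ a.+1 * A * n <= D)%N, (m * 2 ^ a.+1 <= 2 ^ n)%N
    & 7 * lucasU m ^+ 2 * D%:Z ^+ 2 <= 256 * 2 ^+ m].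
Proof.
(* Since 2^n0 = 8^(7^a) is 1 modulo 7^(a+1), every multiple of [n0] satisfies the divisibility. *)
pose n0 := (3 * 7 ^ a)%N; pose M := (16 * 7 ^ a.+1 * A * n0)%N.
have [T leT] := linear_lt_exp M (a + 3).
have [m [D [odd_m le_mD le_BD small]]] := lucasU_small R (2 ^ T).
have D_gt0 : (0 < D)%N by apply: leq_trans le_BD; rewrite expn_gt0.
pose t := trunc_log 2 D.
have /andP[le_tD lt_Dt] : (2 ^ t <= D < 2 ^ t.+1)%N by exact: trunc_log_bounds.
have leTt : (T <= t)%N.
  by rewrite -ltnS -(ltn_exp2l (m := 2)) //; apply: leq_ltn_trans lt_Dt.
(* The last summand makes [r] odd. *)
pose r := (t + a + 2 + ~~ odd (t + a))%N.
have odd_r : odd r by rewrite /r !oddD; case: (odd t); case: (odd a).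
have le_r : (t + a + 2 <= r <= t + (a + 3))%N by rewrite /r; lia.
exists (n0 * r)%N, m, D; split; split=> //.
- by rewrite oddM odd_r /n0 oddM oddX orbT.
- rewrite -subn1 -(eqn_mod_dvd _ _) ?expn_gt0 // /n0 -mulnA expnM.
  have := exp8_mod a r => /(congr1 (modn^~ (7 ^ a.+1)%N)) /eqP.
  rewrite !modn_dvdm ?dvdn_exp2l // => /eqP ->.
  by rewrite addnC mulnC modnMDl.
- apply: leq_trans le_tD; apply: leq_trans (leT t leTt).
  by rewrite /M -!mulnA !leq_mul //; case/andP: le_r.
- apply: (@leq_trans (2 ^ r)); last by rewrite leq_exp2l // leq_pmull // /n0 muln_gt0 expn_gt0.
  apply: (@leq_trans (2 ^ (t + a + 2))); last by rewrite leq_exp2l //; case/andP: le_r.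
  rewrite -addnA addnC (_ : a + 2 + t = a.+1 + t.+1)%N; last lia.
  by rewrite expnD mulnC leq_mul2l (leq_trans le_mD) ?orbT // ltnW.
Qed.

Lemma odd_almost_flat (R : realType) (a A : nat) : (0 < A)%N ->
  exists N (f0 : 'rV['F_2]_N -> int),
  [/\ odd N && (a <= N)%N, forall x, f0 x = 0 \/ f0 x ^+ 2 = 1,
      forall b, A%:Z ^+ 2 * walsh f0 b ^+ 2 <= A.+1%:Z ^+ 2 * 2 ^+ N
    & (#|[pred x | f0 x == 0]| * 2 ^ a <= 2 ^ N)%N].
Proof.
move=> A_gt0.
have [n [m [D [[odd_n odd_m dvd_n] [D_gt0 le_D le_m small]]]]] := parameters R a A.
have n_gt0 : (0 < n)%N by case: n odd_n {dvd_n le_D le_m}.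
have m_gt0 : (0 < m)%N by case: m odd_m {le_m small}.
have [F charF cardF] := pPrimePowerField (isT : prime 2) n_gt0.
have [g prim_g] := finField_prim_root F.
pose v := (7 ^ a.+1)%N; have v_gt0 : (0 < v)%N by rewrite expn_gt0.
have [zeta prim_zeta] := C_prim_root_exists v_gt0.
have dvd_N : (7 ^ a.+1 %| #|F|.-1)%N by rewrite cardF.
have [phi [phiD [phiV phiK phiVK]]] := F2_coordinates charF cardF.
pose cf := @coset_fun F (a.+1) m g.
exists (m * n)%N, (fun x => cf (unpack phiV x)); split.
- rewrite oddM odd_m odd_n /=; apply: (@leq_trans n); last by rewrite leq_pmull.
  rewrite -(leq_exp2l (m := 2)) //; apply: leq_trans le_m.
  by rewrite -[leqLHS]mul1n leq_mul // leq_exp2l.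
- by move=> x; exact: coset_fun_cases.
- move=> b; rewrite (walsh_unpack phiK phiVK (fun y => cf y)).
  have [s s1 approx] := imag_quad_power_approx odd_m D_gt0 small.
  have norm_s : `|s| = 1 by case: s1 => ->; rewrite ?normrN normr1.
  pose e : algC := 16 * n%:R / D%:R.
  have e_ge0 : 0 <= e by rewrite divr_ge0 // mulr_ge0.
  have := @coset_fun_spectrum F n a.+1 m g zeta charF cardF odd_n prim_g dvd_N
    prim_zeta s e (fun i x => sign (dot (row i (vec_mx b)) (phi x)))
    (fun i => addchar_dot phiD _) norm_s e_ge0.
  set W := \sum_y _; move=> bound.
  have {bound} le_W : `|W%:~R| <= (1 + v%:R * e) * sqrtC 2 ^+ (n * m).
    apply: bound => t lt_t.
    have [i lt_i prim_t] := prim_root_pow7 prim_zeta lt_t.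
    have dvd_i : (7 ^ i.+1 %| #|F|.-1)%N by apply: dvdn_trans dvd_N; rewrite dvdn_exp2l.
    have [al [c [alE al_conj le_cn ->]]] :=
      gauss_value charF cardF odd_n prim_g dvd_i prim_t.
    by apply: approx.
  have le_e : A%:R * (1 + v%:R * e) <= A.+1%:R :> algC.
    rewrite mulrDr mulr1 -[A.+1]addn1 natrD lerD2l /e !mulrA.
    rewrite ler_pdivrMr ?ltr0n // mul1r -!natrM ler_nat.
    by apply: leq_trans le_D; rewrite /v; lia.
  have Q_ge0 : 0 <= sqrtC 2 ^+ (n * m) :> algC by rewrite exprn_ge0 // sqrtC_ge0.
  have : A%:R * `|W%:~R| <= A.+1%:R * sqrtC 2 ^+ (n * m) :> algC.
    apply: le_trans (ler_wpM2l _ le_W) _ => //.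
    by rewrite mulrA ler_wpM2r.
  rewrite -(ler_pXn2r (n := 2)) ?nnegrE ?mulr_ge0 // !exprMn exprAC sqrtCK.
  have -> : `|W%:~R| ^+ 2 = (W ^+ 2)%:~R :> algC.
    by rewrite -normrX -rmorphXn /= ger0_norm // ler0z sqr_ge0.
  by rewrite (mulnC m n) -(ler_int algC) !rmorphM !rmorphXn.
rewrite (card_unpack phiK phiVK (fun y => cf y == 0)).
have := coset_fun_zeros charF cardF odd_n prim_g dvd_N prim_zeta m_gt0.
set Z := #|_|; rewrite -/v => le_Z.
have le_v : (2 ^ a.+1 <= v)%N by rewrite leq_exp2r.
have qE : (#|F| ^ m = 2 ^ (m * n))%N by rewrite cardF -expnM mulnC.
have le_q : (m * 2 ^ a.+1 * #|F| ^ m.-1 <= 2 ^ (m * n))%N.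
  have -> : (2 ^ (m * n) = #|F| * #|F| ^ m.-1)%N by rewrite -qE -expnS prednK.
  by rewrite leq_mul2r cardF le_m orbT.
(* The two kinds of zeros each have density at most 2^-(a+1). *)
have : (v * (Z * 2 ^ a.+1) <= v * (2 ^ (m * n) * 2))%N.
  rewrite mulnA (leq_trans (leq_mul le_Z (leqnn _))) // mulnDl.
  rewrite [leqRHS]mulnA muln2 -addnn; apply: leq_add.
    rewrite -mulnA leq_mul2l; apply/orP; right.
    by rewrite mulnAC.
  by rewrite qE mulnC leq_mul2r le_v orbT.
by rewrite leq_pmul2l // expnS mulnCA (mulnC _ 2) leq_pmul2l.
Qed.

Lemma odd_flat (R : realType) (e : R) : 0 < e ->
  exists N B, [/\ odd N, flat N B & B%:~R <= (1 + e) * Num.sqrt 2 ^+ N].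
Proof.
move=> e_gt0.
(* The error e is split in two: 1/A <= e/2 for the spectrum of [f0], and the other half for filling
   in its zeros. *)
pose A := (Num.truncn (2 / e)).+1.
have lt_A : 2 / e < A%:R := truncnS_gt _.
have AR : 0 < A%:R :> R by rewrite ltr0n.
have [N [f0 [/andP[odd_N le_aN] f01 f0B le_Z]]] := @odd_almost_flat R (2 * A).+1 A isT.
(* The added space of size 2^(2s) has just enough characters for the zero set, and 2^s is 2^(N/2)
   divided by 2^(A + 1/2), hence at most e/2 of it. *)
pose s := (N - (2 * A).+1)./2.
have NE : N = (s + s + (2 * A).+1)%N by rewrite /s; lia.
pose q : R := Num.sqrt 2 ^+ N.
have q_gt0 : 0 < q by rewrite exprn_gt0 // sqrtr_gt0.
pose B := Num.floor ((1 + e / 2) * q).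
have le_eA : A%:R^-1 <= e / 2.
  by rewrite -[e / 2]invrK invf_div lef_pV2 ?posrE ?divr_gt0 // ltW.
have walsh_B b : `|walsh f0 b| <= B.
  rewrite /B floor_ge_int intr_norm.
  apply: (@le_trans _ _ ((1 + A%:R^-1) * q)); last by rewrite ler_pM2r // lerD2l.
  have -> : 1 + A%:R^-1 = A.+1%:R / A%:R :> R.
    by rewrite -addn1 natrD mulrDl mulfV ?gt_eqF // mul1r.
  rewrite mulrAC ler_pdivlMr // mulrC.
  rewrite -(ler_pXn2r (n := 2)) ?nnegrE ?mulr_ge0 ?(ltW q_gt0) ?(ltW AR) //.
  rewrite !exprMn real_normK ?num_real // /q exprAC sqr_sqrtr //.
  by have := f0B b; rewrite -(ler_int R) !rmorphM !rmorphXn.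
have card_Z : (#|[pred x | f0 x == 0%R]| <= 2 ^ (s + s))%N.
  by rewrite -(leq_pmul2r (m := 2 ^ (2 * A).+1)) ?expn_gt0 // -expnD -NE.
exists (N + (s + s))%N, (B * 2 ^+ s + 2 ^+ (s + s)); split.
- by rewrite oddD odd_N addnn odd_double.
- exact: flat_fill f01 walsh_B card_Z.
have sqrt2s : Num.sqrt 2 ^+ (s + s) = 2 ^+ s :> R.
  by rewrite addnn -mul2n exprM sqr_sqrtr.
have le_s : 2 ^+ s <= e / 2 * q.
  have -> : q = 2 ^+ s * Num.sqrt 2 ^+ (2 * A).+1 by rewrite -sqrt2s -exprD -NE.
  rewrite mulrCA ler_peMr ?exprn_ge0 //.
  rewrite exprS mulrA exprM sqr_sqrtr //.
  have lt2 : A%:R <= 2 ^+ A :> R by rewrite -natrX ler_nat ltnW // ltn_expl.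
  have s2 : 1 <= Num.sqrt 2 :> R by rewrite -[X in X <= _]sqrtr1 ler_sqrt //; lra.
  have e2A : 1 <= e / 2 * A%:R.
    by rewrite -ler_pdivrMr // mul1r.
  apply: (le_trans e2A); apply: ler_pM => //; rewrite ?(ltW AR) //.
  - by rewrite divr_ge0 // ltW.
  - by rewrite ler_peMr // divr_ge0 // ltW.
rewrite rmorphD rmorphM !rmorphXn /= (exprD _ N) sqrt2s -/q mulrA (exprD _ s s) -mulrDl.
rewrite ler_pM2r ?exprn_gt0 //.
have : B%:~R <= (1 + e / 2) * q by case/andP: (floor_itv ((1 + e / 2) * q)).
by move: le_s; lra.
Qed.

Unset Implicit Arguments.
Local Open Scope classical_set_scope.
Local Open Scope ring_scope.

Theorem theorem1p1 (R : realType) : mu R n @[n --> \oo] --> (1 : R).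
Proof. by apply: mu_cvg_of_flat => e; exact: odd_flat. Qed.
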